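(* Let $a,b,p,q,n$ be positive integers with $n = pa = qb$. If the uniform unicellular passport $[a^{p}, b^{q}, n]$ has genus at least $2$ (i.e. $g = \frac{n-(p+q+1)}{2}+1$ is an integer with $g\ge 2$), then there exists a dessin d'enfant with passport $[a^{p}, b^{q}, n]$ whose automorphism group is trivial. The same statement holds for any passport obtained by permuting the three entries $a^{p}$, $b^{q}$, and $n$.
   Context: A dessin d'enfant (dessin) is a connected finite bipartite graph (vertices coloured black and white, each edge joining a black to a white vertex) embedded as a map in a connected compact oriented surface without boundary. Let $E$ be its edge set, $|E|=n$. Let $x,y\in \mathrm{Sym}(E)$ be the permutations sending each edge to the next edge, counterclockwise, around its black vertex and its white vertex respectively, and let $z=(xy)^{-1}$. The monodromy group is $G=\langle x,y\rangle$, which is transitive on $E$; conversely every pair $(x,y)$ of permutations of a finite set generating a transitive group arises from a dessin. The passport of the dessin is the triple $[\lambda_0,\lambda_1,\lambda_\infty]$ of partitions of $n$ given by the valencies of black vertices, white vertices and faces, i.e. the cycle types of $x,y,z$. The automorphism group of the dessin is the centralizer of $G$ in $\mathrm{Sym}(E)$, i.e. $\{c\in \mathrm{Sym}(E) : cx=xc,\ cy=yc\}$; it is trivial if it consists of the identity only. A passport is uniform if it has the form $[a^{p},b^{q},c^{r}]$ with $n=pa=qb=rc$, where $a^{p}$ denotes the partition of $n$ into $p$ parts all equal to $a$, and $n$ alone denotes the partition with the single part $n$; it is unicellular if one of its entries is the one-part partition $n$. Its genus is $g=\frac{n-(p+q+r)}{2}+1$; for $[a^p,b^q,n]$ one has $r=1$.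 Saying that a passport has genus at least $2$ means that this number is an integer and is $\ge 2$. *)

(* Defs.v *)
From mathcomp Require Import all_boot all_order all_fingroup all_algebra.

Set Implicit Arguments.
Unset Strict Implicit.
Unset Printing Implicit Defensive.

Import GroupScope.

(* A dessin is represented by its monodromy data: the finite set of edges and  *)
(* the counterclockwise rotations of the edges around their black and white    *)
(* end points.  Transitivity on [set: dedge] encodes connectedness, and in     *)
(* MathComp it also forces the edge set to be nonempty.                        *)
Record dessin : Type := Dessin {
  dedge : finType;
  black_rot : {perm dedge};
  white_rot : {perm dedge};
  dessin_transitive :
    [transitive <<[set black_rot; white_rot]>>, on [set: dedge] | 'P]
}.

Definition monodromy (D : dessin) : {group {perm dedge D}} :=
  <<[set black_rot D; white_rot D]>>%G.

(* MathComp composes permutations from left to right; since x * y and y * x    *)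
(* are conjugate, the cycle type of z does not depend on this convention.      *)
Definition face_rot (D : dessin) : {perm dedge D} :=
  (black_rot D * white_rot D)^-1.

(* Fixed points are cycles of length 1: they are counted by porbits.           *)
Definition cycle_type (T : finType) (s : {perm T}) : seq nat :=
  sort geq [seq #|C| | C : {set T} <- enum (porbits s)].

(* Partitions are weakly decreasing sequences of parts, so that equality of    *)
(* passports is plain equality.                                                *)
Definition passport (D : dessin) : 3.-tuple (seq nat) :=
  [tuple cycle_type (black_rot D); cycle_type (white_rot D);
         cycle_type (face_rot D)].

Definition dessin_aut (D : dessin) : {group {perm dedge D}} :=
  'C(monodromy D)%G.

(* Rational-valued, so that neither the difference nor the halving truncates.  *)
Definition passport_genus (n p q r : nat) : rat :=
  ((n%:R - (p + q + r)%N%:R) / 2%:R + 1)%R.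

(* Main.v *)
Require Import Defs.
From mathcomp Require Import all_boot all_order all_fingroup all_algebra.
From mathcomp Require Import zify ring.

(* Up to exchanging [a] and [b] assume [b <= a], and put [N = lcm(a, b)],       *)
(* [n = k N], [p0 = N / a], [q0 = N / b]; integrality of the genus makes [k]    *)
(* and [N - p0 - q0] odd.  For [b >= 3] the starting point is the dessin on     *)
(* [Z/N] whose rotations are the translations by [s] of order [b] and by [t] of *)
(* order [a], with [s + t = 1]: its face rotation is the [N]-cycle [e + 1], but *)
(* its automorphism group is [Z/N].  Parity is exactly what allows such [s] and *)
(* [t] to be chosen.  Conjugating one rotation by a few transpositions, which   *)
(* join the [k] copies of [Z/N] into a chain or, when [k = 1], twist a single   *)
(* copy, keeps the valencies and yields a single face; an automorphism must     *)
(* still act by a translation on every copy, as few edges are affected, and it  *)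
(* must preserve the set of affected edges, which leaves only the identity.     *)
(* The case [b = 2] and the passports with [(a, b) = (3, 3)] or [n = 6] are     *)
(* handled by explicit dessins: there some edge is the only one to satisfy a    *)
(* certain identity between words in the rotations, so automorphisms fix it.    *)

Set Implicit Arguments.
Unset Strict Implicit.
Unset Printing Implicit Defensive.

(** * Rigid dessins *)

Local Open Scope group_scope.

(** A dessin with a single face is a pair of permutations whose product is an [n]-cycle. An
    automorphism commutes with that cycle, so it is trivial as soon as it fixes one edge, and the
    cycle already makes the group transitive. Thus [rigid_dessin_fun] asks only for the valencies, a
    single face, and one fixed edge per automorphism. The order of the three entries is immaterial
    by [rigid_dessin_typeC] and [rigid_dessin_typeR].

    Write [a = d q], [b = d p] with [p], [q] coprime and [N = d p q]. Suitable translations [s] and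
    [t] of [Z/N] come from [coprime_bezout_split]; when [d] is even, oddness of [N + p + q] makes
    [p q] even, which is what the choice modulo 2 requires. The perturbed rotation is [chain_rot] on
    several copies and [twisted_rot] on one, and [chain_face] and [twisted_rot_face] trace the
    single face.

    Rigidity has two stages. An automorphism commutes with translation by [t], so it displaces each
    coset of the multiples of [t] by a constant. The perturbed points are too few to spoil a whole
    coset, hence by [displacement_const] the displacement is constant on each copy. The automorphism
    therefore commutes with translation by [s] as well and preserves the set of perturbed points,
    whose pattern admits no fixed-point-free symmetry ([chain_rigid], [twisted_rot_rigid]).

    The count requires [a > 4]; valencies 4 and 3 pass by a finer count in [Z/12]. The other small
    cases are built by hand, and [rigid_uniform] assembles them all. *)

Definition orbits_of_size (T : finType) (l : nat) (s : {perm T}) : Prop :=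
  forall u, #|porbit s u| = l.

Lemma cycle_type_orbits_of_size (T : finType) (m l : nat) (s : {perm T}) :
  0 < l -> #|T| = (m * l)%N -> orbits_of_size l s -> cycle_type s = nseq m l.
Proof.
move=> l_gt0 cT sl; rewrite /cycle_type.
have pP : partition (porbits s) [set: T].
  have /orbit_partition : [acts <[s]>, on [set: T] | 'P] by apply/actsP => ? ? ?; rewrite !inE.
  have -> // : porbits s = orbit 'P <[s]> @: setT.
  by apply/setP => C; apply/imsetP/imsetP => -[u _ ->]; exists u => //; rewrite porbit.unlock.
have cl C : C \in porbits s -> #|C| = l by case/imsetP => u _ ->.
have cP : #|porbits s| = m.
  have := card_uniform_partition cl pP; rewrite cardsT cT => /eqP.
  by rewrite eqn_pmul2r // => /eqP.
have -> : [seq #|C| | C : {set T} <- enum (porbits s)] = nseq m l.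
  rewrite -cP cardE -(size_map (fun C : {set T} => #|C|)).
  by apply/all_pred1P/allP => k /mapP[C]; rewrite mem_enum => /cl Cl ->; rewrite /= Cl.
apply: sorted_sort; first by move=> ? ? ? /[swap]; apply: leq_trans.
by case: m {cT cP} => //= m; elim: m => //= m ->; rewrite leqnn.
Qed.

Lemma orbits_of_sizeP (T : finType) (l : nat) (s : {perm T}) : 0 < l ->
  (forall u, iter l s u = u) ->
  (forall j u, 0 < j < l -> iter j s u != u) -> orbits_of_size l s.
Proof.
move=> l0 sl sj u; set m := #|porbit s u|.
have m0 : 0 < m by apply/card_gt0P; exists u; apply: porbit_id.
have sm : iter m s u = u := iter_porbit s u.
case: (ltngtP m l) => // [ml|lm].
  by have := sj m u; rewrite m0 ml sm eqxx => /(_ isT).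
have := uniq_traject_porbit s u; rewrite -/m.
have h0 : nth u (traject s u m) 0 = u by rewrite nth_traject.
have hl : nth u (traject s u m) l = u by rewrite nth_traject.
move/uniqP => /(_ u l 0); rewrite !inE !size_traject lm m0 h0 hl => /(_ isT isT erefl).
by move=> l00; rewrite l00 in l0.
Qed.

Lemma porbitJ (T : finType) (s t : {perm T}) u : porbit (s ^ t) (t u) = t @: porbit s u.
Proof.
apply/setP => v; apply/porbitP/imsetP => [[i ->]|[w /porbitP[i ->] ->]].
  exists ((s ^+ i) u); first by apply: mem_porbit.
  by rewrite -conjXg permJ.
by exists i; rewrite -conjXg permJ.
Qed.

Lemma orbits_of_sizeJ (T : finType) l (s t : {perm T}) :
  orbits_of_size l s -> orbits_of_size l (s ^ t).
Proof.
move=> sl u; rewrite -(permKV t u) porbitJ card_imset //; exact: perm_inj.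
Qed.

Lemma orbits_of_sizeV (T : finType) l (s : {perm T}) :
  orbits_of_size l s -> orbits_of_size l s^-1.
Proof. by move=> sl u; rewrite porbitV. Qed.

(* The three entries are the orbit sizes of the rotations about the black *)
(* vertices, the white vertices and the faces.                            *)
Definition rigid_dessin_type (n l0 l1 l2 : nat) : Prop :=
  exists (T : finType) (x y : {perm T}),
    [/\ #|T| = n, [transitive <<[set x; y]>>, on [set: T] | 'P],
        'C(<<[set x; y]>>) = 1 &
        [/\ orbits_of_size l0 x, orbits_of_size l1 y
          & orbits_of_size l2 (x * y)^-1]].

(** After the exchange, the face rotation is conjugate to the old one by [x]. *)
Lemma rigid_dessin_typeC n l0 l1 l2 :
  rigid_dessin_type n l0 l1 l2 -> rigid_dessin_type n l1 l0 l2.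
Proof.
move=> [T [x [y [cT tr ce [hx hy hz]]]]]; exists T, y, x.
rewrite setUC; split=> //; split=> //.
have -> : (y * x)^-1 = (x * y)^-1 ^ x by rewrite conjVg conjgE !mulgA mulVg mul1g.
exact: orbits_of_sizeJ.
Qed.

(** The pair [x], [(x * y)^-1] generates the same group, and its own face rotation is a conjugate of
    [y]. Together with the exchange of [x] and [y] this reaches all six orders. *)
Lemma rigid_dessin_typeR n l0 l1 l2 :
  rigid_dessin_type n l0 l1 l2 -> rigid_dessin_type n l0 l2 l1.
Proof.
move=> [T [x [y [cT tr ce [hx hy hz]]]]]; exists T, x, (x * y)^-1.
have -> : <<[set x; (x * y)^-1]>> = <<[set x; y]>>.
  apply/eqP; rewrite eqEsubset !gen_subG !subUset !sub1set.
  have inx A : x \in <<[set x; A]>> by rewrite mem_gen // !inE eqxx.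
  have inA A : A \in <<[set x; A]>> by rewrite mem_gen // !inE eqxx orbT.
  rewrite !inx /= groupV; apply/andP; split; first exact: groupM (inx _) (inA _).
  rewrite -{1}(mulKg x y); apply: groupM; first by rewrite groupV inx.
  by rewrite -groupV inA.
split=> //; split=> //.
have -> : (x * (x * y)^-1)^-1 = y ^ x^-1 by rewrite invMg invgK conjgE invgK mulgA.
exact: orbits_of_sizeJ.
Qed.

Lemma rigid_dessin_of_type (n m0 m1 m2 l0 l1 l2 : nat) :
    n = (m0 * l0)%N -> n = (m1 * l1)%N -> n = (m2 * l2)%N -> 0 < n ->
    rigid_dessin_type n l0 l1 l2 ->
  exists D : dessin,
    passport D = [tuple nseq m0 l0; nseq m1 l1; nseq m2 l2] /\ dessin_aut D = 1%G.
Proof.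
move=> n0 n1 n2 np [T [x [y [cT tr ce [hx hy hz]]]]].
exists (Dessin tr); split; last exact/val_inj.
have pos m l : n = (m * l)%N -> 0 < l by move=> nE; move: np; rewrite nE muln_gt0 => /andP[].
apply/val_inj; rewrite /= /face_rot /=.
rewrite (cycle_type_orbits_of_size (pos _ _ n0) (etrans cT n0) hx).
rewrite (cycle_type_orbits_of_size (pos _ _ n1) (etrans cT n1) hy).
by rewrite (cycle_type_orbits_of_size (pos _ _ n2) (etrans cT n2) hz).
Qed.

(* [F] stands for the map sending a point to its orbit under [y \o x]. *)
Lemma rigid_dessin_fun (T : finType) (x y : T -> T) (a b n : nat) (u0 : T) :
    #|T| = n -> 0 < a -> 0 < b ->
    (forall u, iter b x u = u) -> (forall j u, 0 < j < b -> iter j x u != u) ->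
    (forall u, iter a y u = u) -> (forall j u, 0 < j < a -> iter j y u != u) ->
    (forall F : T -> {set T}, (forall u, F (y (x u)) = F u) -> forall u, F u = F u0) ->
    (forall c : T -> T, injective c -> (forall u, c (x u) = x (c u)) ->
       (forall u, c (y u) = y (c u)) -> exists u, c u = u) ->
  rigid_dessin_type n b a n.
Proof.
move=> cT a0 b0 xb xj ya yj zF cF.
have inj l f : 0 < l -> (forall u : T, iter l f u = u) -> injective f.
  case: l => // l _ fl u v fuv; rewrite -(fl u) -(fl v).
  by rewrite !iterSr fuv.
have xi := inj _ _ b0 xb; have yi := inj _ _ a0 ya.
pose X := perm xi; pose Y := perm yi.
have iX j u : iter j X u = iter j x u by elim: j => //= j ->; rewrite permE.
have iY j u : iter j Y u = iter j y u by elim: j => //= j ->; rewrite permE.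
(* Taking orbits under [X * Y] for [F] shows that there is one orbit: the single face, and also
   transitivity. *)
have zT u : porbit (X * Y) u = [set: T].
  have zE v : porbit (X * Y) (y (x v)) = porbit (X * Y) v.
    have -> : y (x v) = (X * Y) v by rewrite permM !permE.
    by apply/eqP; rewrite eq_porbit_mem (mem_porbit _ 1).
  have {}zF := zF (fun v => porbit (X * Y) v) zE.
  by apply/setP => v; rewrite inE -eq_porbit_mem (zF u) (zF v) eqxx.
exists T, X, Y; split=> //.
- apply/imsetP; exists u0; rewrite ?inE //; apply/setP => v; rewrite inE.
  have : v \in porbit (X * Y) u0 by rewrite zT inE.
  case/porbitP => i ->; apply/esym/orbitP; exists ((X * Y) ^+ i) => //.
  by rewrite groupX // groupM // mem_gen // !inE eqxx ?orbT.
- apply/trivgP/subsetP => c /centP cc; rewrite inE; apply/eqP.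
  have cx u : c (x u) = x (c u).
    have /permP/(_ u) : c * X = X * c by apply: cc; rewrite mem_gen // !inE eqxx.
    by rewrite !permM !permE.
  have cy u : c (y u) = y (c u).
    have /permP/(_ u) : c * Y = Y * c by apply: cc; rewrite mem_gen // !inE eqxx orbT.
    by rewrite !permM !permE.
  have [u cu] := cF c (@perm_inj _ c) cx cy.
  (* The fixed points of [c] are a union of orbits of [X * Y], hence everything once there is one.
     [setT] and [set0] serve as truth values, since [F] takes values in [{set T}]. *)
  have {}zF := zF (fun v => if c v == v then setT else set0) _.
  have {}zF : forall v, (if c v == v then [set: T] else set0)
                 = (if c u0 == u0 then setT else set0).
    by apply: zF => v; rewrite cy cx (inj_eq yi) (inj_eq xi).
  have E : [set: T] != set0 by apply/set0Pn; exists u0.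
  have c0 : c u0 == u0.
    by move: (zF u); rewrite cu eqxx; case: ifP => // _ /eqP; rewrite (negPf E).
  apply/permP => v; rewrite perm1; apply/eqP.
  by move: (zF v); rewrite c0; case: ifP => // _ /esym/eqP; rewrite (negPf E).
split.
- by apply: orbits_of_sizeP => // *; rewrite iX ?xb ?xj.
- by apply: orbits_of_sizeP => // *; rewrite iY ?ya ?yj.
- by apply: orbits_of_sizeV => u; rewrite zT cardsT.
Qed.

Local Close Scope group_scope.

(** * Dessins whose edges form a rectangular grid *)

Definition in_grid (K N : nat) (p : nat * nat) : bool := (p.1 < K) && (p.2 < N).

Definition row_next (N : nat) (p : nat * nat) : nat * nat :=
  (p.1, if p.2.+1 == N then 0 else p.2.+1).

Lemma row_next_in_grid K N p : in_grid K N p -> in_grid K N (row_next N p).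
Proof. by rewrite /in_grid /row_next /= => /andP[-> h] /=; case: eqP => //; lia. Qed.

Lemma iter_row_next N j p : p.2 < N -> j <= N ->
  iter j (row_next N) p = (p.1, if p.2 + j < N then p.2 + j else p.2 + j - N).
Proof.
case: p => i e /= eN; elim: j => [|j IH] jN /=; first by rewrite addn0 eN.
rewrite IH ?(ltnW jN) // /row_next /=; congr pair.
by case: (ltnP (e + j)) => h1; case: (ltnP (e + j.+1)) => h2; case: ifP => /eqP; lia.
Qed.

(* The white vertices are the rows of a [K] by [N] grid, each row being *)
(* cyclically ordered by [row_next].                                    *)
Lemma rigid_dessin_grid (K N b : nat) (X : nat * nat -> nat * nat) :
    0 < K -> 0 < N -> 0 < b ->
    (forall p, in_grid K N p -> in_grid K N (X p)) ->
    (forall p, in_grid K N p -> iter b X p = p) ->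
    (forall j p, 0 < j < b -> in_grid K N p -> iter j X p != p) ->
    (forall (T : Type) (F : nat * nat -> T),
        (forall p, in_grid K N p -> F (row_next N (X p)) = F p) ->
      forall p, in_grid K N p -> F p = F (0, 0)) ->
    (forall c : nat * nat -> nat * nat,
        (forall p, in_grid K N p -> in_grid K N (c p)) ->
        (forall p, in_grid K N p -> c (X p) = X (c p)) ->
        (forall p, in_grid K N p -> c (row_next N p) = row_next N (c p)) ->
      exists2 p, in_grid K N p & c p = p) ->
  rigid_dessin_type (K * N) b N (K * N).
Proof.
move=> K0 N0 b0 XI Xb Xj XF Xc.
pose T := ('I_K * 'I_N)%type.
pose v (u : T) : nat * nat := (u.1 : nat, u.2 : nat).
pose g (p : nat * nat) : T := (insubd (Ordinal K0) p.1, insubd (Ordinal N0) p.2).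
have vI u : in_grid K N (v u) by rewrite /in_grid /= !ltn_ord.
have gK p : in_grid K N p -> v (g p) = p.
  by case: p => i e /andP[iK eN]; rewrite /v /g /= !val_insubd iK eN.
have vK u : g (v u) = u.
  by case: u => i e; congr pair; apply: val_inj; rewrite val_insubd ltn_ord.
have v_inj : injective v := can_inj vK.
pose x u := g (X (v u)); pose y u := g (row_next N (v u)).
have vx u : v (x u) = X (v u) by rewrite gK ?XI.
have vy u : v (y u) = row_next N (v u) by rewrite gK ?row_next_in_grid.
have ix j u : v (iter j x u) = iter j X (v u) by elim: j => //= j <-; rewrite vx.
have iy j u : v (iter j y u) = iter j (row_next N) (v u) by elim: j => //= j <-; rewrite vy.
apply: (@rigid_dessin_fun T x y N b _ (g (0, 0))) => //.
- by rewrite card_prod !card_ord.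
- by move=> u; apply: v_inj; rewrite ix Xb.
- by move=> j u jb; apply/negP => /eqP/(congr1 v); rewrite ix => /eqP; apply/negP/Xj.
- move=> u; apply: v_inj; rewrite iy iter_row_next // ?ltn_ord //.
  by rewrite ifN ?addnK // -leqNgt leq_addl.
- move=> j u jN; apply/negP => /eqP/(congr1 v); rewrite iy iter_row_next ?ltn_ord //; last lia.
  by case: u => i e [] /=; have := ltn_ord e; case: (ltnP (e + j)); lia.
- move=> F FE u; rewrite -[u in LHS]vK; apply: (XF _ (F \o g)) => // p pI /=.
  by rewrite -[RHS]FE; congr F; apply: v_inj; rewrite vy vx !gK // row_next_in_grid ?XI.
- move=> c ci cx cy.
  have [|p pI|p pI|p pI cp] := Xc (v \o c \o g) => /=.
  + by move=> p pI; apply: vI.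
  + by rewrite -vx -cx; congr (v (c _)); apply: v_inj; rewrite vx !gK // XI.
  + by rewrite -vy -cy; congr (v (c _)); apply: v_inj; rewrite vy !gK // row_next_in_grid.
  by exists (g p); apply: v_inj; rewrite gK.
Qed.

(** * Explicit dessins *)

(** The twist by [m = 2] used for the valencies [2 b] and [b] needs [2 m + 2 < N], which fails for
    [N = 6]. Here the black rotation has the cycles [0 1 3] and [2 4 5]. *)
Lemma rigid_6_3 : rigid_dessin_type 6 3 6 6.
Proof.
pose X (p : nat * nat) := (0, nth 0 [:: 1; 3; 4; 0; 5; 2] p.2).
have grid (P : nat * nat -> Prop) : P (0, 0) -> P (0, 1) -> P (0, 2) -> P (0, 3) ->
    P (0, 4) -> P (0, 5) -> forall p, in_grid 1 6 p -> P p.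
  by move=> ? ? ? ? ? ? [[|i] [|[|[|[|[|[|e]]]]]]].
apply: (@rigid_dessin_grid 1 6 3 X) => //.
- by apply: grid.
- by apply: grid.
- move=> [|[|[|j]]] p // _; move: p.
  + by apply: (grid (fun p => iter 1 X p != p)).
  + by apply: (grid (fun p => iter 2 X p != p)).
- move=> T F FE.
  move: (FE (0, 0) isT) (FE (0, 1) isT) (FE (0, 2) isT) (FE (0, 3) isT) (FE (0, 4) isT).
  by rewrite /X /row_next /= => *; apply: (grid (fun p => F p = F (0, 0))); congruence.
- move=> c cI cX cY; exists (0, 0) => //.
  (* The first identity holds at positions 0 and 4, the second excludes 4. *)
  pose P p := X p = row_next 6 p /\ X (row_next 6 p) = row_next 6 (row_next 6 (row_next 6 p)).
  have Pc : P (c (0, 0)).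
    by split; rewrite -?cY -?cX.
  by move: Pc; move: (c _) (cI (0, 0) isT); apply: (grid (fun p => P p -> p = (0, 0))) => // -[].
Qed.

(** Innermost conditions are split first and arithmetically impossible branches vanish, so that a
    rotation given by cases can be evaluated at symbolic coordinates. *)
Ltac decide_ifs :=
  repeat match goal with |- context [if ?b then _ else _] =>
    lazymatch b with
    | context [if _ then _ else _] => fail
    | _ => let H := fresh "H" in destruct b eqn:H; try (exfalso; lia); simpl
    end end.

Lemma rigid_3_3 (k : nat) : odd k -> 2 < k -> rigid_dessin_type (k * 3) 3 3 (k * 3).
Proof.
move=> k_odd k_gt2.
(* A generic black vertex is [(i, 0)], [(i - 1, 2)], [(i - 2, 1)]. The two remaining ones sit at the
   ends: one meets row 0 twice and row 1 once, the other meets row [k - 1] twice and row [k - 2]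
   once. *)
pose X (p : nat * nat) : nat * nat :=
  if p.2 == 0 then if p.1 == 0 then (1, 0) else (p.1.-1, 2)
  else if p.2 == 1 then
    if p.1 == k.-1 then (k.-1, 2) else if p.1 == k.-2 then (k.-1, 1) else (p.1.+2, 0)
  else if p.1 == 0 then (0, 0) else (p.1.-1, 1).
have grid (P : nat * nat -> Prop) :
    (forall i, i < k -> P (i, 0)) -> (forall i, i < k -> P (i, 1)) ->
    (forall i, i < k -> P (i, 2)) -> forall p, in_grid k 3 p -> P p.
  by move=> ? ? ? [i [|[|[|e]]]] /andP[/= ik //] _; auto.
apply: (@rigid_dessin_grid k 3 3 X) => //; first lia.
- by apply: grid => i ik; rewrite /in_grid /X /=; decide_ifs; lia.
- apply: (grid (fun p => iter 3 X p = p)) => i ik; rewrite /X /=; decide_ifs; congr pair; lia.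
- move=> [|[|[|j]]] // p _ pI; apply/eqP; move: p pI.
  + apply: (grid (fun p => iter 1 X p <> p)) => i ik; rewrite /X /=; decide_ifs => -[]; lia.
  + apply: (grid (fun p => iter 2 X p <> p)) => i ik; rewrite /X /=; decide_ifs => -[]; lia.
- move=> T F FE.
  (* Along the face, columns 0 and 2 move by one row and column 1 by two rows, which leaves four
     runs to be joined at the ends. *)
  have F0 i : i.+1 < k -> F (i.+1, 0) = F (i, 0).
    by move=> ik; rewrite -(FE (i.+1, 0)) /in_grid /X /row_next //= ik.
  have F2 i : i.+1 < k -> F (i.+1, 2) = F (i, 2).
    by move=> ik; rewrite -(FE (i.+1, 2)) /in_grid /X /row_next //= ik.
  have F1 i : i.+2 < k -> F (i, 1) = F (i.+2, 1).
    move=> ik; rewrite -(FE (i, 1)) /in_grid /X /row_next /=; last lia.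
    by decide_ifs; congr F; congr pair; lia.
  have G0 i : i < k -> F (i, 0) = F (0, 0).
    by elim: i => // i IH ik; rewrite F0 // IH // ltnW.
  have G2 i : i < k -> F (i, 2) = F (0, 2).
    by elim: i => // i IH ik; rewrite F2 // IH // ltnW.
  (* As [k] is odd, the even rows of column 1 run up to row [k - 1], where the face passes to column
     0. *)
  have [m km] : exists m, k = m.*2.+1 by exists k./2; lia.
  have G1 j : j <= m -> F (j.*2, 1) = F (0, 1).
    by elim: j => // j IH jm; rewrite doubleS -F1 ?IH //; lia.
  have H1 j : j < m -> F (j.*2.+1, 1) = F (1, 1).
    by elim: j => // j IH jm; rewrite doubleS -F1 ?IH //; lia.
  have E1 : F (1, 1) = F (0, 0).
    by rewrite -(FE (0, 0)) // /in_grid /=; lia.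
  have E2 : F (k.-2, 1) = F (k.-1, 2).
    rewrite -(FE (k.-2, 1)) /in_grid /X /row_next /=; last lia.
    by decide_ifs; congr F; congr pair; lia.
  have E3 : F (0, 2) = F (0, 1).
    by rewrite -(FE (0, 2)) // /in_grid /=; lia.
  have E4 : F (k.-1, 1) = F (0, 0).
    rewrite -(G0 k.-1) -?(FE (k.-1, 1)) /in_grid /X /row_next /=; last lia; last lia.
    by decide_ifs.
  have E5 : F (0, 1) = F (0, 0).
    by rewrite -(G1 m) // -E4; congr F; congr pair; lia.
  have E6 : F (0, 2) = F (0, 0) by rewrite E3 E5.
  apply: (grid (fun p => F p = F (0, 0))) => i ik; first exact: G0.
    case: (boolP (odd i)) => oi.
      by rewrite -E1 -(H1 i./2); [congr F; congr pair; lia | lia].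
    by rewrite -E5 -(G1 i./2); [congr F; congr pair; lia | lia].
  by rewrite G2.
- move=> c cI cX cY; exists (k.-1, 1); first by rewrite /in_grid /=; lia.
  pose Y := row_next 3.
  (* The first identity holds at [(k - 1, 1)] and [(0, 2)], where an end vertex meets its row twice
     in succession; the second tells the two ends apart. *)
  pose P p := X p = Y p /\ X (X (Y (X (X p)))) = Y (Y p).
  have XI p : in_grid k 3 p -> in_grid k 3 (X p).
    by move: p; apply: grid => i ik; rewrite /in_grid /X /=; decide_ifs; lia.
  have YI := @row_next_in_grid k 3.
  have pI : in_grid k 3 (k.-1, 1) by rewrite /in_grid /=; lia.
  have : P (c (k.-1, 1)).
    have P0 : P (k.-1, 1) by rewrite /P /X /Y /row_next /=; decide_ifs; split=> //; congr pair; lia.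
    by case: P0 => P1 P2; split; rewrite /Y -!(cX, cY) -/Y ?P2 ?P1 //; auto.
  move: (c _) (cI _ pI); apply: (grid (fun p => P p -> p = (k.-1, 1))) => i ik;
    rewrite /P /Y /row_next /X /=; decide_ifs => -[e1 e2];
    move: (congr1 fst e1) (congr1 snd e1) (congr1 fst e2) (congr1 snd e2) => /= *;
    congr pair; lia.
Qed.

(** On the only white vertex, [e] is joined to the opposite point [e + h], except for the pairs
    [0, h + 1], then [1, h + 2], and [2, h]. The face advances by two in two turns almost
    everywhere, and the exceptional pairs splice its even and odd runs. *)
Lemma rigid_2_even_one (h : nat) : ~~ odd h -> 2 < h ->
  rigid_dessin_type (h.*2) 2 (h.*2) (h.*2).
Proof.
move=> h_even h_gt2.
pose X (p : nat * nat) : nat * nat := (0,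
  if p.2 == 0 then h.+1 else if p.2 == 1 then h.+2 else if p.2 == 2 then h
  else if p.2 == h then 2 else if p.2 == h.+1 then 0 else if p.2 == h.+2 then 1
  else if p.2 < h then p.2 + h else p.2 - h).
have grid (P : nat * nat -> Prop) :
    (forall e, e < h.*2 -> P (0, e)) -> forall p, in_grid 1 h.*2 p -> P p.
  by move=> ? [[|i] e] /andP[/= ? ?] //; auto.
have -> : h.*2 = 1 * h.*2 by rewrite mul1n.
have XI : forall p, in_grid 1 h.*2 p -> in_grid 1 h.*2 (X p).
  by apply: grid => e eh; rewrite /in_grid /X /=; decide_ifs; lia.
rewrite {2}mul1n.
apply: (@rigid_dessin_grid 1 h.*2 2 X) => //; first lia.
- by apply: (grid (fun p => iter 2 X p = p)) => e eh; rewrite /X /=; decide_ifs; congr pair; lia.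
- move=> [|[|j]] // p _ pI; apply/eqP; move: p pI.
  by apply: (grid (fun p => iter 1 X p <> p)) => e eh; rewrite /X /=; decide_ifs => -[]; lia.
- move=> T F FE.
  have E e f : e < h.*2 -> row_next h.*2 (X (0, e)) = (0, f) -> F (0, e) = F (0, f).
    by move=> eh <-; rewrite FE // /in_grid /= eh.
  have e0 : F (0, 0) = F (0, h.+2) by apply: E; rewrite ?/X ?/row_next /=; decide_ifs; try congr pair; lia.
  have e1 : F (0, 1) = F (0, h.+3) by apply: E; rewrite ?/X ?/row_next /=; decide_ifs; try congr pair; lia.
  have e2 : F (0, 2) = F (0, h.+1) by apply: E; rewrite ?/X ?/row_next /=; decide_ifs; try congr pair; lia.
  have e3 : F (0, h) = F (0, 3) by apply: E; rewrite ?/X ?/row_next /=; decide_ifs; try congr pair; lia.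
  have e4 : F (0, h.+1) = F (0, 1) by apply: E; rewrite ?/X ?/row_next /=; decide_ifs; try congr pair; lia.
  have e5 : F (0, h.+2) = F (0, 2) by apply: E; rewrite ?/X ?/row_next /=; decide_ifs; try congr pair; lia.
  have lo e : 2 < e < h.-1 -> F (0, e) = F (0, e + h.+1).
    by move=> eh; apply: E; rewrite ?/X ?/row_next /=; decide_ifs; try congr pair; lia.
  have lo0 : F (0, h.-1) = F (0, 0).
    by apply: E; rewrite ?/X ?/row_next /=; decide_ifs; try congr pair; lia.
  have hi e : 2 < e < h -> F (0, e + h) = F (0, e.+1).
    by move=> eh; apply: E; rewrite ?/X ?/row_next /=; decide_ifs; try congr pair; lia.
  have step e : 2 < e -> e.+2 <= h -> F (0, e.+2) = F (0, e).
    by move=> e2' eh; rewrite (lo e) ?addnS -?addSn ?hi //; lia.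
  have [m hm] : exists m, h = m.*2 by exists h./2; lia.
  have G0 j : 1 < j <= m -> F (0, j.*2) = F (0, 4).
    elim: j => // j IH jm; case: (eqVneq j 1) => [-> //|j1].
    by rewrite doubleS step ?IH //; lia.
  have G1 j : 0 < j < m -> F (0, j.*2.+1) = F (0, 3).
    elim: j => // j IH jm; case: (eqVneq j 0) => [-> //|j1].
    by rewrite doubleS step ?IH //; lia.
  have H3 : F (0, h.+3) = F (0, 4) by rewrite -(hi 3); [congr F; congr pair; lia | lia].
  have K0 : F (0, 3) = F (0, 0).
    by rewrite -lo0 -(G1 m.-1); [congr F; congr pair; lia | lia].
  have K4 : F (0, 4) = F (0, h) by rewrite hm G0 //; lia.
  have K1 : F (0, h.+1) = F (0, 0) by congruence.
  have low e : e <= h -> F (0, e) = F (0, 0).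
    move=> eh; case: (boolP (odd e)) => oe.
      case: (eqVneq e 1) => [->|]; first by congruence.
      by move=> ?; rewrite -K0 -(G1 e./2); [congr F; congr pair; lia | lia].
    case: (eqVneq e 0) => [->//|?]; case: (eqVneq e 2) => [->|?]; first by congruence.
    have -> : F (0, 0) = F (0, 4) by congruence.
    by rewrite -(G0 e./2); [congr F; congr pair; lia | lia].
  apply: (grid (fun p => F p = F (0, 0))) => e eh.
  case: (leqP e h) => he; first exact: low.
  case: (eqVneq e h.+1) => [->|?]; first by congruence.
  case: (eqVneq e h.+2) => [->|?]; first by congruence.
  have -> : e = (e - h) + h by lia.
  by rewrite hi ?low //; lia.
- move=> c cI cX cY; exists (0, 0); first by rewrite /in_grid /=; lia.
  pose Y := row_next h.*2; pose Z p := iter h.+1 Y p.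
  have YI := @row_next_in_grid 1 h.*2.
  have ZE p : in_grid 1 h.*2 p -> Z p = (p.1, if p.2 + h.+1 < h.*2 then p.2 + h.+1 else p.2 + h.+1 - h.*2).
    by case/andP => _ ph; rewrite /Z iter_row_next //; lia.
  have cZ p : in_grid 1 h.*2 p -> c (Z p) = Z (c p).
    move=> pI; rewrite /Z; have jI j : in_grid 1 h.*2 (iter j Y p) by elim: j => //= j; apply: YI.
    by elim: h.+1 => //= j IH; rewrite cY ?IH.
  (* Only 0 and 1 are joined to the point [h + 1] further on, so 0 is the only such point whose
     successor is another. *)
  pose P p := X p = Z p /\ X (Y p) = Z (Y p).
  have pI : in_grid 1 h.*2 (0, 0) by rewrite /in_grid /=; lia.
  have : P (c (0, 0)).
    have [P1 P2] : P (0, 0).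
      rewrite /P !ZE //; last exact: YI.
      by rewrite /X /Y /row_next /=; decide_ifs; split; congr pair; lia.
    by split; rewrite /Y -!(cX, cY) -/Y -?cZ ?P2 ?P1 //; auto.
  move: (c _) (cI _ pI); apply: (grid (fun p => P p -> p = (0, 0))) => e eh [].
  have eI : in_grid 1 h.*2 (0, e) by rewrite /in_grid /=; lia.
  rewrite !ZE //; last exact: YI.
  by rewrite /X /Y /row_next /= => -[e1] -[e2]; congr pair; move: e1 e2; decide_ifs; lia.
Qed.

(* Every cycle of [X] joins two rows: row 0 carries a loop at every pair of *)
(* opposite points but one, and rows [2 j + 1] and [2 j + 2] are joined by  *)
(* [2 h - 1] edges.                                                         *)
Lemma rigid_2_even (m h : nat) : ~~ odd h -> 1 < h -> 0 < m ->
  rigid_dessin_type (m.*2.+1 * h.*2) 2 (h.*2) (m.*2.+1 * h.*2).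
Proof.
move=> h_even h_gt1 m_gt0.
pose X (p : nat * nat) : nat * nat :=
  if p.1 == 0 then
    if p.2 == 0 then (1, 0) else if p.2 == h then (m.*2, 0)
    else (0, if p.2 < h then p.2 + h else p.2 - h)
  else if odd p.1 then
    if p.2 == 0 then (p.1.-1, 0) else (p.1.+1, if p.2 == h.*2.-1 then 1 else p.2.+1)
  else
    if p.2 == 0 then if p.1 == m.*2 then (0, h) else (p.1.+1, 0)
    else (p.1.-1, if p.2 == 1 then h.*2.-1 else p.2.-1).
have grid (P : nat * nat -> Prop) : (forall e, e < h.*2 -> P (0, e)) ->
    (forall j e, j < m -> e < h.*2 -> P (j.*2.+1, e)) ->
    (forall j e, j < m -> e < h.*2 -> P (j.*2.+2, e)) ->
    forall p, in_grid m.*2.+1 h.*2 p -> P p.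
  move=> PL PA PB [i e] /andP[/= im eh]; case: i im => [|i] im; first exact: PL.
  case: (boolP (odd i)) => oi.
    by rewrite (_ : i.+1 = i./2.*2.+2); [apply: PB => //; lia | lia].
  by rewrite (_ : i.+1 = i./2.*2.+1); [apply: PA => //; lia | lia].
have XI : forall p, in_grid m.*2.+1 h.*2 p -> in_grid m.*2.+1 h.*2 (X p).
  by apply: grid => [e|j e jm|j e jm] eh; rewrite /in_grid /X /= ?odd_double /=; decide_ifs; lia.
apply: (@rigid_dessin_grid _ h.*2 2 X) => //; first lia.
- by apply: (grid (fun p => iter 2 X p = p)) => [e|j e jm|j e jm] eh;
    rewrite /X /= ?odd_double /=; decide_ifs; congr pair; lia.
- move=> [|[|j]] // p _ pI; apply/eqP; move: p pI.
  by apply: (grid (fun p => iter 1 X p <> p)) => [e|j e jm|j e jm] eh;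
    rewrite /X /= ?odd_double /=; decide_ifs => -[]; lia.
- move=> T F FE.
  have E i e q : i < m.*2.+1 -> e < h.*2 -> row_next h.*2 (X (i, e)) = q -> F (i, e) = F q.
    by move=> im eh <-; rewrite FE // /in_grid /= im eh.
  have AB j e : j < m -> 0 < e -> e.+2 < h.*2 -> F (j.*2.+1, e) = F (j.*2.+2, e.+2).
    by move=> jm e0 eh; apply: E; rewrite ?/X ?/row_next /= ?odd_double /=; decide_ifs; try congr pair; lia.
  have BA j e : j < m -> 1 < e < h.*2 -> F (j.*2.+2, e) = F (j.*2.+1, e).
    by move=> jm e0; apply: E; rewrite ?/X ?/row_next /= ?odd_double /=; decide_ifs; try congr pair; lia.
  have A1 j : j < m -> F (j.*2.+1, h.*2.-1) = F (j.*2.+2, 2).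
    by move=> jm; apply: E; rewrite ?/X ?/row_next /= ?odd_double /=; decide_ifs; try congr pair; lia.
  have A2 j : j < m -> F (j.*2.+1, h.*2.-2) = F (j.*2.+2, 0).
    by move=> jm; apply: E; rewrite ?/X ?/row_next /= ?odd_double /=; decide_ifs; try congr pair; lia.
  have B1 j : j < m -> F (j.*2.+2, 1) = F (j.*2.+1, 0).
    by move=> jm; apply: E; rewrite ?/X ?/row_next /= ?odd_double /=; decide_ifs; try congr pair; lia.
  have BB j : j.+1 < m -> F (j.*2.+2, 0) = F (j.+1.*2.+1, 1).
    by move=> jm; apply: E; rewrite ?/X ?/row_next /= ?odd_double /=; decide_ifs; try congr pair; lia.
  have AA j : j.+1 < m -> F (j.+1.*2.+1, 0) = F (j.*2.+2, 1).
    by move=> jm; apply: E; rewrite ?/X ?/row_next /= ?odd_double /=; decide_ifs; try congr pair; lia.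
  have A0 : F (1, 0) = F (0, 1).
    by apply: E; rewrite ?/X ?/row_next /= ?odd_double /=; decide_ifs; try congr pair; lia.
  have L0 : F (0, 0) = F (1, 1).
    by apply: E; rewrite ?/X ?/row_next /= ?odd_double /=; decide_ifs; try congr pair; lia.
  have Lh : F (0, h) = F (m.*2, 1).
    by apply: E; rewrite ?/X ?/row_next /= ?odd_double /=; decide_ifs; try congr pair; lia.
  have Ll e : 0 < e < h.-1 -> F (0, e) = F (0, e + h.+1).
    by move=> eh; apply: E; rewrite ?/X ?/row_next /= ?odd_double /=; decide_ifs; try congr pair; lia.
  have Ll' : F (0, h.-1) = F (0, 0).
    by apply: E; rewrite ?/X ?/row_next /= ?odd_double /=; decide_ifs; try congr pair; lia.
  have Lr e : 0 < e < h -> F (0, e + h) = F (0, e.+1).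
    by move=> eh; apply: E; rewrite ?/X ?/row_next /= ?odd_double /=; decide_ifs; try congr pair; lia.
  have Ls e : 0 < e -> e.+2 <= h -> F (0, e.+2) = F (0, e).
    by move=> e2' eh; rewrite (Ll e) ?addnS -?addSn ?Lr //; lia.
  have Ao j e : j < m -> e.*2.+1 < h.*2 -> F (j.*2.+1, e.*2.+1) = F (j.*2.+1, 1).
    by move=> jm; elim: e => // e IH eh; rewrite doubleS -BA -?AB ?IH //; lia.
  have Ae j e : j < m -> 0 < e < h -> F (j.*2.+1, e.*2) = F (j.*2.+1, 2).
    move=> jm; elim: e => // e IH eh; case: (eqVneq e 0) => [-> //|e0].
    by rewrite doubleS -BA -?AB ?IH //; lia.
  have Aoe j : j < m -> F (j.*2.+1, 2) = F (j.*2.+1, 1).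
    move=> jm; rewrite -BA -?A1 -1?(@Ao _ h.-1) //; try lia.
    by congr F; congr pair; lia.
  have A j e : j < m -> 0 < e < h.*2 -> F (j.*2.+1, e) = F (j.*2.+1, 1).
    move=> jm eh; case: (boolP (odd e)) => oe.
      by rewrite -(@Ao _ e./2) //; [congr F; congr pair; lia | lia].
    by rewrite -Aoe // -(@Ae _ e./2) //; [congr F; congr pair; lia | lia].
  (* Two strands of the face run along the chain, [S] through the bundles of parallel edges and [R]
     through the positions 0. Both are traced back to row 0, where [L01] identifies them. *)
  have S j : j < m -> F (j.*2.+1, 1) = F (0, 0).
    elim: j => [|j IH] jm; first by rewrite L0.
    by rewrite -BB // -A2 ?A ?IH //; lia.
  have R j : j < m -> F (j.*2.+1, 0) = F (0, 1).
    by elim: j => [|j IH] jm; [rewrite A0 | rewrite AA // B1 ?IH //; lia].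
  have L1 e : e.*2.+1 < h -> F (0, e.*2.+1) = F (0, 1).
    by elim: e => // e IH eh; rewrite doubleS Ls ?IH //; lia.
  have L01 : F (0, 1) = F (0, 0).
    by rewrite -Ll' -(@L1 (h./2.-1)); [congr F; congr pair; lia | lia].
  have L2 e : 0 < e -> e.*2 <= h -> F (0, e.*2) = F (0, 2).
    elim: e => // e IH e0 eh; case: (eqVneq e 0) => [-> //|ne0].
    by rewrite doubleS Ls ?IH //; lia.
  have L02 : F (0, 2) = F (0, 0).
    rewrite -(@L2 h./2); [|lia|lia].
    have -> : h./2.*2 = h by lia.
    have -> : F (0, h) = F (m.-1.*2.+2, 1) by rewrite Lh; congr F; congr pair; lia.
    by rewrite B1 ?R ?L01 //; lia.
  have L e : e <= h -> F (0, e) = F (0, 0).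
    move=> eh; case: (boolP (odd e)) => oe.
      by rewrite -L01 -(@L1 e./2); [congr F; congr pair; lia | lia].
    case: (eqVneq e 0) => [->//|e0].
    by rewrite -L02 -(@L2 e./2); [congr F; congr pair; lia | lia | lia].
  apply: (grid (fun p => F p = F (0, 0))) => [e|j e jm|j e jm] eh.
  + case: (leqP e h) => he; first exact: L.
    have -> : e = (e - h) + h by lia.
    by rewrite Lr ?L //; lia.
  + case: (eqVneq e 0) => [->|e0]; first by rewrite R // L01.
    by rewrite A ?S //; lia.
  + case: (eqVneq e 0) => [->|e0]; first by rewrite -A2 // A ?S //; lia.
    case: (eqVneq e 1) => [->|e1]; first by rewrite B1 // R // L01.
    by rewrite BA ?A ?S //; lia.
- move=> c cI cX cY; pose p0 := (1, h.*2.-1).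
  have pI : in_grid m.*2.+1 h.*2 p0 by rewrite /in_grid /=; lia.
  exists p0 => //; pose Y := row_next h.*2; pose Z p := iter h Y p.
  have YI := @row_next_in_grid m.*2.+1 h.*2.
  have ZE p : in_grid m.*2.+1 h.*2 p ->
      Z p = (p.1, if p.2 + h < h.*2 then p.2 + h else p.2 + h - h.*2).
    by case/andP => _ ph; rewrite /Z iter_row_next //; lia.
  have jI j p : in_grid m.*2.+1 h.*2 p -> in_grid m.*2.+1 h.*2 (iter j Y p).
    by move=> qI; elim: j => //= j; apply: YI.
  have cj j p : in_grid m.*2.+1 h.*2 p -> c (iter j Y p) = iter j Y (c p).
    by move=> qI; elim: j => //= j IH; rewrite cY ?IH ?jI.
  have cZ p : in_grid m.*2.+1 h.*2 p -> c (Z p) = Z (c p) by apply: cj.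
  (* At [p0], the first two identities express that the bundle joining rows 1 and 2 continues in
     parallel beyond position 0 of row 1. The third says that the edge at that position leads to row
     0, where the next edge is a loop between opposite points. *)
  pose P p := [/\ Y (X p) = X (Y (Y p)), Y (X (Y (Y p))) = X (Y (Y (Y p)))
                & X (Y (X (Y p))) = Z (Y (X (Y p)))].
  have : P (c p0).
    have [P1 P2 P3] : P p0.
      rewrite /P !ZE //; last exact: (YI _ (XI _ (YI _ pI))).
      by rewrite /X /Y /row_next /= ?odd_double /=; decide_ifs; split; congr pair; lia.
    by split; rewrite /Y -!(cX, cY) -/Y -?cZ ?P3 ?P2 ?P1 //; auto.
  move: (c _) (cI _ pI) => p {}pI; have := pI; move: p pI.
  apply: (grid (fun p => in_grid m.*2.+1 h.*2 p -> P p -> p = p0)) => [e|j e jm|j e jm] eh eI [];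
    (rewrite !ZE //; last exact: (YI _ (XI _ (YI _ eI))));
    rewrite /X /Y /row_next /p0 /= ?odd_double /=; decide_ifs => e1 e2 e3;
    move: (congr1 fst e1) (congr1 snd e1) (congr1 fst e2) (congr1 snd e2)
      (congr1 fst e3) (congr1 snd e3) => /= *; congr pair; lia.
Qed.

(** The two white vertices are joined position by position from 4 on. The first four positions carry
    one loop at each vertex and two skew edges, arranged so that exchanging the vertices is not a
    symmetry. *)
Lemma rigid_2_odd_one (a : nat) : odd a -> 4 < a -> rigid_dessin_type (2 * a) 2 a (2 * a).
Proof.
move=> a_odd a_gt4.
pose X (p : nat * nat) : nat * nat :=
  if p.1 == 0 then
    if p.2 == 0 then (0, 2) else if p.2 == 1 then (1, 0) else if p.2 == 2 then (0, 0)
    else if p.2 == 3 then (1, 2) else (1, p.2)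
  else
    if p.2 == 0 then (0, 1) else if p.2 == 1 then (1, 3) else if p.2 == 2 then (0, 3)
    else if p.2 == 3 then (1, 1) else (0, p.2).
have grid (P : nat * nat -> Prop) : (forall e, e < a -> P (0, e)) ->
    (forall e, e < a -> P (1, e)) -> forall p, in_grid 2 a p -> P p.
  by move=> P0 P1 [[|[|i]] e] /andP[/= ? ?] //; auto.
have XI : forall p, in_grid 2 a p -> in_grid 2 a (X p).
  by apply: grid => e ea; rewrite /in_grid /X /=; decide_ifs; lia.
apply: (@rigid_dessin_grid _ a 2 X) => //; first lia.
- by apply: (grid (fun p => iter 2 X p = p)) => e ea; rewrite /X /=; decide_ifs; congr pair; lia.
- move=> [|[|j]] // p _ pI; apply/eqP; move: p pI.
  by apply: (grid (fun p => iter 1 X p <> p)) => e ea; rewrite /X /=; decide_ifs => -[]; lia.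
- move=> T F FE.
  have E i e q : i < 2 -> e < a -> row_next a (X (i, e)) = q -> F (i, e) = F q.
    by move=> im eh <-; rewrite FE // /in_grid /= im eh.
  have A0 : F (0, 0) = F (0, 3) by apply: E; rewrite ?/X ?/row_next /=; decide_ifs; try congr pair; lia.
  have A1 : F (0, 1) = F (1, 1) by apply: E; rewrite ?/X ?/row_next /=; decide_ifs; try congr pair; lia.
  have A2 : F (0, 2) = F (0, 1) by apply: E; rewrite ?/X ?/row_next /=; decide_ifs; try congr pair; lia.
  have A3 : F (0, 3) = F (1, 3) by apply: E; rewrite ?/X ?/row_next /=; decide_ifs; try congr pair; lia.
  have B0 : F (1, 0) = F (0, 2) by apply: E; rewrite ?/X ?/row_next /=; decide_ifs; try congr pair; lia.
  have B1 : F (1, 1) = F (1, 4) by apply: E; rewrite ?/X ?/row_next /=; decide_ifs; try congr pair; lia.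
  have B2 : F (1, 2) = F (0, 4) by apply: E; rewrite ?/X ?/row_next /=; decide_ifs; try congr pair; lia.
  have B3 : F (1, 3) = F (1, 2) by apply: E; rewrite ?/X ?/row_next /=; decide_ifs; try congr pair; lia.
  have A e : 3 < e -> e.+1 < a -> F (0, e) = F (1, e.+1).
    by move=> *; apply: E; rewrite ?/X ?/row_next /=; decide_ifs; try congr pair; lia.
  have B e : 3 < e -> e.+1 < a -> F (1, e) = F (0, e.+1).
    by move=> *; apply: E; rewrite ?/X ?/row_next /=; decide_ifs; try congr pair; lia.
  have Aa : F (0, a.-1) = F (1, 0).
    by apply: E; rewrite ?/X ?/row_next /=; decide_ifs; try congr pair; lia.
  have Ba : F (1, a.-1) = F (0, 0).
    by apply: E; rewrite ?/X ?/row_next /=; decide_ifs; try congr pair; lia.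
  have Ae e : 1 < e -> e.*2 < a -> F (0, e.*2) = F (0, 4).
    elim: e => // e IH e1 ea; case: (eqVneq e 1) => [-> //|ne].
    by rewrite doubleS -B -?A ?IH //; lia.
  have Be e : 1 < e -> e.*2 < a -> F (1, e.*2) = F (1, 4).
    elim: e => // e IH e1 ea; case: (eqVneq e 1) => [-> //|ne].
    by rewrite doubleS -A -?B ?IH //; lia.
  have A4 : F (0, 4) = F (1, 0).
    by rewrite -Aa -(Ae a./2); [congr F; congr pair; lia | lia | lia].
  have B4 : F (1, 4) = F (0, 0).
    by rewrite -Ba -(Be a./2); [congr F; congr pair; lia | lia | lia].
  have AA e : 3 < e -> e < a -> ~~ odd e -> F (0, e) = F (0, 0).
    move=> e3 ea oe; rewrite (_ : e = e./2.*2) ?Ae; [congruence | lia..].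
  have BB e : 3 < e -> e < a -> ~~ odd e -> F (1, e) = F (0, 0).
    move=> e3 ea oe; rewrite (_ : e = e./2.*2) ?Be; [congruence | lia..].
  apply: (grid (fun p => F p = F (0, 0))) => e ea.
  + case: (ltnP 3 e) => e3; last by case: e e3 ea => [|[|[|[|e]]]] //; congruence.
    case: (boolP (odd e)) => oe; last exact: AA.
    by rewrite (_ : e = e.-1.+1) -?B ?BB //; lia.
  + case: (ltnP 3 e) => e3; last by case: e e3 ea => [|[|[|[|e]]]] //; congruence.
    case: (boolP (odd e)) => oe; last exact: BB.
    by rewrite (_ : e = e.-1.+1) -?A ?AA //; lia.
- move=> c cI cX cY; pose p0 := (0, 0); pose Y := row_next a.
  have pI : in_grid 2 a p0 by rewrite /in_grid /=; lia.
  exists p0 => //; have YI := @row_next_in_grid 2 a.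
  (* The first identity detects the loops, at [(0, 0)] and [(1, 1)]; the second tells them apart. *)
  pose P p := X p = Y (Y p) /\ X (Y (Y (Y p))) = Y (Y (X (Y p))).
  have : P (c p0).
    have [P1 P2] : P p0.
      by rewrite /P /X /Y /row_next /=; decide_ifs.
    by split; rewrite /Y -!(cX, cY) -/Y ?P2 ?P1 //; auto 7.
  move: (c _) (cI _ pI); apply: (grid (fun p => P p -> p = p0)) => e eh [];
    rewrite /X /Y /row_next /p0 /=; decide_ifs => e1 e2;
    move: (congr1 fst e1) (congr1 snd e1) (congr1 fst e2) (congr1 snd e2) => /= *; congr pair; lia.
Qed.

(* Every cycle of [X] joins two rows: rows [2 i] and [2 i + 1] are joined by *)
(* [a - 2] parallel edges; the other two edges at each row form a chain with *)
(* an asymmetric beginning.                                                  *)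
Lemma rigid_2_odd (k a : nat) : odd k -> 2 < k -> odd a -> 2 < a ->
  rigid_dessin_type (k.*2 * a) 2 a (k.*2 * a).
Proof.
move=> k_odd k_gt2 a_odd a_gt2.
pose opp r := if odd r then r.-1 else r.+1.
pose X (p : nat * nat) : nat * nat :=
  if 1 < p.2 then (opp p.1, p.2)
  else if p.2 == 0 then
    if 5 < p.1 then (p.1.-2, 1) else nth (0, 0) [:: (3,1); (5,0); (0,1); (1,1); (2,1); (1,0)] p.1
  else
    if 3 < p.1 then if p.1.+2 < k.*2 then (p.1.+2, 0) else (opp p.1, 1)
    else nth (0, 0) [:: (2,0); (3,0); (4,0); (0,0)] p.1.
have grid (P : nat * nat -> Prop) : (forall e, e < a -> P (0, e)) ->
    (forall e, e < a -> P (1, e)) -> (forall e, e < a -> P (2, e)) ->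
    (forall e, e < a -> P (3, e)) -> (forall e, e < a -> P (4, e)) ->
    (forall e, e < a -> P (5, e)) ->
    (forall r e, 2 < r < k -> e < a -> P (r.*2, e)) ->
    (forall r e, 2 < r < k -> e < a -> P (r.*2.+1, e)) ->
    forall p, in_grid k.*2 a p -> P p.
  move=> ? ? ? ? ? ? P0 P1 [r e] /andP[/= rk ea].
  case: (ltnP r 6) => r6; first by case: r rk r6 => [|[|[|[|[|[|r]]]]]] //; auto.
  case: (boolP (odd r)) => odr.
    by rewrite (_ : r = r./2.*2.+1); [apply: P1 => //; lia | lia].
  by rewrite (_ : r = r./2.*2); [apply: P0 => //; lia | lia].
have XI : forall p, in_grid k.*2 a p -> in_grid k.*2 a (X p).
  by apply: grid => [e|e|e|e|e|e|r e rk|r e rk] ea;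
    rewrite /in_grid /X /opp /= ?odd_double /=; decide_ifs; lia.
apply: (@rigid_dessin_grid _ a 2 X) => //; try lia.
- by apply: (grid (fun p => iter 2 X p = p)) => [e|e|e|e|e|e|r e rk|r e rk] ea;
    rewrite /X /opp /= ?odd_double /=; decide_ifs; congr pair; lia.
- move=> [|[|j]] // p _ pI; apply/eqP; move: p pI.
  by apply: (grid (fun p => iter 1 X p <> p)) => [e|e|e|e|e|e|r e rk|r e rk] ea;
    rewrite /X /opp /= ?odd_double /=; decide_ifs => -[]; lia.
- move=> T F FE.
  have E i e q : i < k.*2 -> e < a -> row_next a (X (i, e)) = q -> F (i, e) = F q.
    by move=> im eh <-; rewrite FE // /in_grid /= im eh.
  have oppK r : opp (opp r) = r by rewrite /opp; decide_ifs; lia.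
  have oppI r : r < k.*2 -> opp r < k.*2 by move=> rk; rewrite /opp; decide_ifs; lia.
  have Fs r e : r < k.*2 -> 1 < e -> e.+1 < a -> F (r, e) = F (opp r, e.+1).
    by move=> rk e1 ea; apply: E; rewrite ?/X ?/row_next /=; decide_ifs; try congr pair; lia.
  have Fl r : r < k.*2 -> F (r, a.-1) = F (opp r, 0).
    by move=> rk; apply: E; rewrite ?/X ?/row_next /=; decide_ifs; try congr pair; lia.
  have Fe r e : r < k.*2 -> 0 < e -> e.*2 < a -> F (r, e.*2) = F (r, 2).
    move=> rk; elim: e => // e IH e1 ea; case: (eqVneq e 0) => [-> //|ne].
    by rewrite doubleS -(oppK r) -Fs ?oppK ?oppI -?Fs ?IH //; lia.
  (* As [a] is odd, the face entering the bundle at position 2 leaves it for position 0 of the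
     opposite row, so only columns 0 and 1 remain to be followed. *)
  have F2 r : r < k.*2 -> F (r, 2) = F (opp r, 0).
    by move=> rk; rewrite -Fl // -(@Fe r a./2) //; [congr F; congr pair; lia | lia | lia].
  have u0 r : 5 < r -> r < k.*2 -> F (r, 0) = F (opp r.-2, 0).
    by move=> r5 rk; rewrite -F2; [apply: E|]; rewrite ?/X ?/row_next /=; decide_ifs; try congr pair; lia.
  have u1 r : 3 < r -> r.+2 < k.*2 -> F (r, 1) = F (r.+2, 1).
    by move=> r5 rk; apply: E; rewrite ?/X ?/row_next /=; decide_ifs; try congr pair; lia.
  have u2 r : 3 < r -> r < k.*2 -> k.*2 <= r.+2 -> F (r, 1) = F (r, 0).
    move=> r5 rk rk2; rewrite -{2}(oppK r) -F2 ?oppI //.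
    by apply: E; rewrite ?/X ?/row_next /=; decide_ifs; try congr pair; lia.
  have w : [/\ F (0, 0) = F (3, 2), F (0, 1) = F (2, 1), F (1, 0) = F (5, 1),
               F (1, 1) = F (3, 1) & F (2, 0) = F (0, 2)].
    by split; apply: E; rewrite ?/X ?/row_next /=; decide_ifs; try congr pair; lia.
  have v : [/\ F (2, 1) = F (4, 1), F (3, 0) = F (1, 2), F (3, 1) = F (0, 1),
               F (4, 0) = F (2, 2) & F (5, 0) = F (1, 1)].
    by split; apply: E; rewrite ?/X ?/row_next /=; decide_ifs; try congr pair; lia.
  have [w1 w2 w3 w4 w5] := w; have [v1 v2 v3 v4 v5] := v.
  rewrite !F2 // in w1 w5 v2 v4; try lia.
  have u4 r : 3 < r -> r.+4 < k.*2 -> F (r.+4, 0) = F (r, 0).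
    move=> r3 rk; have oppSS : opp r.+2 = (opp r).+2 by rewrite /opp; decide_ifs; lia.
    have r3' : 3 < opp r by rewrite /opp; decide_ifs; lia.
    have rk' : (opp r).+2 < k.*2 by rewrite -oppSS oppI //; lia.
    have h1 : F (r.+4, 0) = F (opp r.+2, 0) by apply: (u0 r.+4); lia.
    have h2 : F ((opp r).+2, 0) = F (opp (opp r), 0) by apply: (u0 (opp r).+2); lia.
    by rewrite h1 oppSS h2 oppK.
  (* Column 0 moves by four rows at a time. With [k = 2 l + 3], rows [4 + 4 l] and [5 + 4 l] are the
     last two, where [u2] joins columns 0 and 1. *)
  have [l kl] : exists l, k = l.*2.+3 by exists (k - 3)./2; lia.
  have y0 j : j <= l -> F (4 + j * 4, 0) = F (4, 0).
    by elim: j => // j IH jl; rewrite -IH; [rewrite -(u4 (4 + j * 4)); [congr F; congr pair; lia | lia | lia] | lia].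
  have y1 j : j <= l -> F (5 + j * 4, 0) = F (5, 0).
    by elim: j => // j IH jl; rewrite -IH; [rewrite -(u4 (5 + j * 4)); [congr F; congr pair; lia | lia | lia] | lia].
  have z0 j : j.*2 + 4 < k.*2 -> F (j.*2 + 4, 1) = F (4, 1).
    by elim: j => // j IH jl; rewrite doubleS !addSn -u1 ?IH //; lia.
  have z1 j : j.*2 + 5 < k.*2 -> F (j.*2 + 5, 1) = F (5, 1).
    by elim: j => // j IH jl; rewrite doubleS !addSn -u1 ?IH //; lia.
  have t0 : F (4, 1) = F (4, 0).
    by rewrite -(@z0 l.*2) -?(@y0 l) ?u2 //; [congr F; congr pair; lia | lia..].
  have t1 : F (5, 1) = F (5, 0).
    by rewrite -(@z1 l.*2) -?(@y1 l) ?u2 //; [congr F; congr pair; lia | lia..].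
  rewrite /opp /= in w1 w5 v2 v4.
  have G0 r : r < k.*2 -> F (r, 0) = F (0, 0).
    elim/ltn_ind: r => r IH rk; case: (ltnP r 6) => r6.
      by case: r rk r6 {IH} => [|[|[|[|[|[|r]]]]]] // *; congruence.
    by rewrite u0 // IH // /opp; decide_ifs; lia.
  have G1 r : r < k.*2 -> F (r, 1) = F (0, 0).
    move=> rk; case: (ltnP r 4) => r4.
      by case: r rk r4 => [|[|[|[|r]]]] // *; congruence.
    case: (boolP (odd r)) => ro.
      have <- : F (5, 1) = F (0, 0) by congruence.
      by rewrite -(@z1 (r - 5)./2); [congr F; congr pair; lia | lia].
    have <- : F (4, 1) = F (0, 0) by congruence.
    by rewrite -(@z0 (r - 4)./2); [congr F; congr pair; lia | lia].
  have G2 r : r < k.*2 -> F (r, 2) = F (0, 0) by move=> rk; rewrite F2 // G0 // oppI.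
  move=> [r e] /andP[/= rk ea].
  case: (ltnP 1 e) => e1; last by case: e ea e1 => [|[|e]] // _ _; [apply: G0 | apply: G1].
  case: (boolP (odd e)) => oe.
    rewrite Fs //; last lia.
    by rewrite (_ : e.+1 = e.+1./2.*2) ?Fe ?G2 ?oppI //; lia.
  by rewrite (_ : e = e./2.*2) ?Fe ?G2 //; lia.
- move=> c cI cX cY; pose p0 := (3, 0); pose Y := row_next a.
  have pI : in_grid k.*2 a p0 by rewrite /in_grid /=; lia.
  exists p0 => //; have YI := @row_next_in_grid k.*2 a.
  (* [S] holds only at [(3, 0)] and [(0, 0)]. The map [X \o Y] sends [(3, 0)] to [(0, 0)] but
     [(0, 0)] to [(2, 0)], so [P] selects [(3, 0)]. *)
  pose S p := X (Y (X p)) = Y (Y (X (Y p))); pose P p := S p /\ S (X (Y p)).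
  have : P (c p0).
    have [P1 P2] : P p0.
      by rewrite /P /S /X /Y /row_next /opp /=; decide_ifs; split; congr pair; lia.
    by rewrite /P /S in P1 P2 *; split; rewrite /Y -!(cX, cY) -/Y ?P2 ?P1 //; auto 7.
  have S01 v p : v < 2 -> in_grid k.*2 a p -> p.2 = v -> S p -> p = (3, 0) \/ p = (0, 0).
    move=> v2; move: p.
    apply: (grid (fun p => p.2 = v -> S p -> p = (3, 0) \/ p = (0, 0))) =>
      [e|e|e|e|e|e|r e rk|r e rk] ea /= ee; rewrite {}ee {e ea}; case: v v2 => [|[|v]] // _;
      rewrite /S /X /Y /row_next /opp /= ?odd_double /=; decide_ifs => e1;
      move: (congr1 fst e1) (congr1 snd e1) => /= *; first [by left; congr pair; lia | by right; congr pair; lia].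
  have SP p : in_grid k.*2 a p -> S p -> p = (3, 0) \/ p = (0, 0).
    case: p => r e pJ Se; have [/= rk ea] := andP pJ.
    have ne : opp r != r by rewrite /opp; decide_ifs; lia.
    case: (ltnP 1 e) => e1; [exfalso | move: pJ Se].
      case: (ltnP e.+1 a) => e2; move: Se; rewrite /S /Y /row_next /= [X (r, e)]/X /= e1 /=.
        rewrite (ltn_eqF e2) /X /= (leqW e1) /opp => /(congr1 fst) /=.
        by move: ne; rewrite /opp; decide_ifs; lia.
      have -> : e.+1 = a by lia.
      rewrite eqxx => /(congr1 fst) /=; move: rk; rewrite /opp /X /= => rk.
      case: (ltnP r 6) => r6; first by case: r rk r6 {ne pJ} => [|[|[|[|[|[|r]]]]]].
      by decide_ifs; lia.
    by move=> pJ; apply: (S01 e).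
  case=> S1 S2; have [//|c0] := SP _ (cI _ pI) S1; move: S2; rewrite c0.
  by rewrite /S /X /Y /row_next /opp /=; decide_ifs => -[]; lia.
Qed.

(** * Dessins close to translations of Z/N *)

Import GRing.Theory.
Local Open Scope ring_scope.

Definition shift (I : Type) (V : zmodType) (s : V) (u : I * V) : I * V := (u.1, u.2 + s).

Lemma iter_shift (I : Type) (V : zmodType) (s : V) j (u : I * V) :
  iter j (shift s) u = (u.1, u.2 + s *+ j).
Proof.
elim: j => [|j IH]; first by rewrite mulr0n addr0; case: u.
by rewrite iterS IH /shift /= -addrA -mulrSr.
Qed.

(* [c] maps cosets of [<t>] to cosets of [<t>]; if [x] is the translation by [s] *)
(* at some point of [u + <t>] and at its image, then [c] displaces [u] and       *)
(* [u + s] by the same amount.                                                   *)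
Section AlmostTranslation.
Variables (I : finType) (V : finZmodType) (a : nat) (s t : V).
Variables (x : I * V -> I * V) (B : {set I * V}).
Hypothesis t_order : forall j, (0 < j < a)%N -> t *+ j != 0.
Hypothesis t_expo : t *+ a = 0.
Hypothesis a_gt0 : (0 < a)%N.
Hypothesis xB : forall u, u \notin B -> x u = shift s u.
Variable c : I * V -> I * V.
Hypothesis c_inj : injective c.
Hypothesis cx : forall u, c (x u) = x (c u).
Hypothesis cy : forall u, c (shift t u) = shift t (c u).

Definition displacement (u : I * V) : I * V := ((c u).1, (c u).2 - u.2).

Definition coset_of_shift (u : I * V) : {set I * V} :=
  [set (u.1, u.2 + t *+ j) | j : 'I_a].

Lemma mem_coset_of_shift u j : (u.1, u.2 + t *+ j) \in coset_of_shift u.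
Proof.
apply/imsetP; exists (Ordinal (ltn_pmod j a_gt0)) => //=; congr (_, _ + _).
by rewrite [in LHS](divn_eq j a) mulrnDr mulnC mulrnA t_expo mul0rn add0r.
Qed.

Lemma card_coset_of_shift u : #|coset_of_shift u| = a.
Proof.
rewrite card_imset ?card_ord // => j j' [] /addrI.
wlog: j j' / (j <= j')%N.
  by move=> W; case/orP: (leq_total j j') => jj E; [apply: W | apply/esym/W].
move=> jj E; apply/eqP/negPn/negP => ne.
have /t_order : (0 < j' - j < a)%N.
  by move: ne; rewrite -val_eqE /= => ne; have := ltn_ord j'; lia.
by rewrite mulrnBr // E subrr eqxx.
Qed.

Lemma iter_c j u : c (u.1, u.2 + t *+ j) = ((c u).1, (c u).2 + t *+ j).
Proof.
rewrite -!iter_shift; elim: j => //= j IH; by rewrite cy IH.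
Qed.

Lemma displacement_t u j : displacement (u.1, u.2 + t *+ j) = displacement u.
Proof.
rewrite /displacement iter_c /=; congr pair.
by rewrite opprD addrACA subrr addr0.
Qed.

Lemma displacement_s u :
    (#|B :&: coset_of_shift u| + #|B :&: coset_of_shift (c u)| < a)%N ->
  displacement (shift s u) = displacement u.
Proof.
move=> small.
(* [c] maps the coset of [u] into that of [c u] injectively, so fewer than [a] of its [a] points lie
   in [B] or are sent into [B]. *)
have [v vO /norP[vB cvB]] : exists2 v, v \in coset_of_shift u & ~~ ((v \in B) || (c v \in B)).
  apply/exists_inP; rewrite -negb_forall_in; apply: contraL small => /forall_inP bad.
  rewrite -leqNgt -{1}(card_coset_of_shift u).
  have -> : #|B :&: coset_of_shift (c u)| = #|c @^-1: (B :&: coset_of_shift (c u))|.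
    by rewrite on_card_preimset //; apply/onW_bij/injF_bij.
  apply: leq_trans (leq_card_setU _ _); apply: subset_leq_card; apply/subsetP => v vO.
  rewrite !inE vO andbT; case/orP: (bad v vO) => -> //; apply/orP; right=> /=.
  by case/imsetP: vO => j _ ->; rewrite iter_c mem_coset_of_shift.
case/imsetP: vO => j _ vE.
have <- : displacement v = displacement u by rewrite vE displacement_t.
have <- : displacement (shift s v) = displacement (shift s u).
  by rewrite vE -(displacement_t (shift s u) j) /shift /= addrAC.
rewrite /displacement -(xB vB) cx (xB cvB) (xB vB) /shift /=; congr pair.
by rewrite opprD addrACA subrr addr0.
Qed.

End AlmostTranslation.

Ltac nat_lia :=
  repeat match goal with H : ?P |- _ =>
    lazymatch P with context [Zp_trunc] => clear H end end; lia.

Lemma Zp_natr_inj (N m n : nat) : (1 < N)%N -> (m < N)%N -> (n < N)%N ->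
  m%:R = n%:R :> 'Z_N -> m = n.
Proof.
by move=> N1 mN nN /(congr1 val); rewrite /= !val_Zp_nat // !modn_small.
Qed.

Lemma Zp_natr_neq0 (N m : nat) : (0 < m < N)%N -> m%:R != 0 :> 'Z_N.
Proof.
move=> mN; apply/eqP => E.
have := @Zp_natr_inj N m 0 _ _ _ E; lia.
Qed.

(** Refutes two simultaneous coincidences between perturbed points: the difference of the equations
    is a nonzero constant, as [ring] checks. *)
Lemma ring_absurd (V : comPzRingType) (P : Prop) (r l1 r1 l2 r2 : V) :
  r != 0 -> l1 = r1 -> l2 = r2 -> r = (l1 - r1) - (l2 - r2) -> P.
Proof. by move=> /eqP r0 -> -> E; case: r0; rewrite E !subrr. Qed.

(** * Several copies of Z/N joined in a chain *)

Section Chain.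
Variables (k N s' : nat).
Hypotheses (k_even : ~~ odd k) (k_gt1 : (1 < k)%N) (N_gt4 : (4 < N)%N).
Hypothesis s'_range : (1 < s' < N.-1)%N.
Let s : 'Z_N := s'%:R.
Let t : 'Z_N := 1 - s.
Let T : finType := ('I_k.+1 * 'Z_N)%type.

(* Copy [i] of ['Z_N] is joined to copy [i + 1] by conjugating the translation *)
(* by [s] with the transposition of [(i, 1)] and [(i + 1, 0)].                 *)
Definition chain_swap (u : 'I_k.+1 * 'Z_N) : 'I_k.+1 * 'Z_N :=
  if (u.2 == 1) && (u.1 < k)%N then (inord u.1.+1, 0)
  else if (u.2 == 0) && (0 < u.1)%N then (inord u.1.-1, 1) else u.
Let h := chain_swap.

Definition chain_rot (u : 'I_k.+1 * 'Z_N) : 'I_k.+1 * 'Z_N := h (shift s (h u)).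
Let x := chain_rot.

Let N_gt1 : (1 < N)%N. Proof. by nat_lia. Qed.
Let s_neq0 : s != 0. Proof. by apply: Zp_natr_neq0; nat_lia. Qed.
Let s_neq1 : s != 1.
Proof. by apply/eqP => /(@Zp_natr_inj N s' 1 N_gt1); nat_lia. Qed.
Let s_neqN1 : s + 1 != 0.
Proof. by rewrite /s natr1; apply: Zp_natr_neq0; nat_lia. Qed.
Let one_neq0 : 1 != 0 :> 'Z_N. Proof. exact: (@Zp_natr_neq0 N 1). Qed.

Let shiftE (i : 'I_k.+1) (e r : 'Z_N) : shift r (i, e) = (i, e + r).
Proof. by []. Qed.

Let hdef (i : 'I_k.+1) e : h (i, e) =
  if (e == 1) && (i < k)%N then (inord i.+1, 0)
  else if (e == 0) && (0 < i)%N then (inord i.-1, 1) else (i, e).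
Proof. by []. Qed.

Let hE (i : 'I_k.+1) e : e != 0 -> e != 1 -> h (i, e) = (i, e).
Proof. by move=> e0 e1; rewrite hdef (negPf e0) (negPf e1). Qed.

Let h1 (i : 'I_k.+1) : (i < k)%N -> h (i, 1) = (inord i.+1, 0).
Proof. by move=> ik; rewrite hdef eqxx ik. Qed.

Let h0 (i : 'I_k.+1) : (0 < i)%N -> h (i, 0) = (inord i.-1, 1).
Proof. by move=> ik; rewrite hdef eqxx ik eq_sym (negPf one_neq0). Qed.

Let hfix (i : 'I_k.+1) e :
  (e == 1) ==> (k <= i)%N -> (e == 0) ==> (i == 0%N :> nat) -> h (i, e) = (i, e).
Proof.
rewrite hdef => ik i0; case: (e == 1) ik => /= [ik|_]; first rewrite ltnNge ik /=.
  by case: (e == 0) i0 => //= /eqP ->.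
by case: (e == 0) i0 => //= /eqP ->.
Qed.

Lemma chain_swapK : involutive h.
Proof.
move=> [i e]; have ik := ltn_ord i.
have [[i1 ->]|[[i0 ->]|fix_ie]] :
    (i < k)%N /\ e = 1 \/ ((0 < i)%N /\ e = 0 \/ h (i, e) = (i, e)).
- case: (eqVneq e 1) => [->|e1].
    case: (ltnP i k) => ik'; first by left.
    by right; right; apply: hfix; rewrite ?ik' ?implybT // (negPf one_neq0).
  case: (eqVneq e 0) => [->|e0]; last by right; right; rewrite hE.
  case: (ltnP 0 i) => i0; first by right; left.
  by right; right; apply: hfix; rewrite ?leqn0 in i0 *; rewrite ?i0 ?implybT // eq_sym (negPf one_neq0).
- rewrite h1 // h0 inordK //.
  by congr pair; apply: val_inj; rewrite /= inordK //; nat_lia.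
- rewrite h0 // h1 inordK; try nat_lia.
  by congr pair; apply: val_inj; rewrite /= inordK //; nat_lia.
by rewrite !fix_ie.
Qed.

Lemma iter_chain_rot j u : iter j x u = h (iter j (shift s) (h u)).
Proof.
by elim: j => [|j IH] /=; rewrite ?chain_swapK // IH /x /chain_rot -/h chain_swapK.
Qed.

Let one_add_s : 1 + s != 0 /\ 1 + s != 1.
Proof. by rewrite addrC s_neqN1 -subr_eq0 addrK s_neq0. Qed.

Let one_sub_s : 1 - s != 0 /\ 1 - s != 1.
Proof. by rewrite subr_eq0 eq_sym s_neq1 -subr_eq0 addrAC subrr add0r oppr_eq0 s_neq0. Qed.

Let opp_s : - s != 0 /\ - s != 1.
Proof. by rewrite oppr_eq0 s_neq0 -subr_eq0 -opprD oppr_eq0 s_neqN1. Qed.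

Lemma chain_rot1 (i : 'I_k.+1) : (i < k)%N -> x (i, 1) = (inord i.+1, s).
Proof. by move=> ik; rewrite /x /chain_rot -/h h1 // shiftE add0r hE. Qed.

Lemma chain_rot0 (i : 'I_k.+1) : (0 < i)%N -> x (i, 0) = (inord i.-1, 1 + s).
Proof. by move=> ik; case: one_add_s => *; rewrite /x /chain_rot -/h h0 // shiftE hE. Qed.

Lemma chain_rot1s (i : 'I_k.+1) : (i < k)%N -> x (i, 1 - s) = (inord i.+1, 0).
Proof. by move=> ik; case: one_sub_s => *; rewrite /x /chain_rot -/h (@hE i (1 - s)) // shiftE subrK h1. Qed.

Lemma chain_rotNs (i : 'I_k.+1) : (0 < i)%N -> x (i, - s) = (inord i.-1, 1).
Proof. by move=> ik; case: opp_s => *; rewrite /x /chain_rot -/h (@hE i (- s)) // shiftE addNr h0. Qed.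

(** The points moved by the swap and their translates by [- s]: exactly those where [x] is not the
    translation by [s]. *)
Definition chain_cut (u : 'I_k.+1 * 'Z_N) : bool :=
  [|| (u.1 < k)%N && ((u.2 == 1) || (u.2 == 1 - s))
    | (0 < u.1)%N && ((u.2 == 0) || (u.2 == - s))].

Let cutE (i : 'I_k.+1) (e : 'Z_N) : chain_cut (i, e) =
  [|| (i < k)%N && ((e == 1) || (e == 1 - s)) | (0 < i)%N && ((e == 0) || (e == - s))].
Proof. by []. Qed.

Lemma chain_rot_shift u : ~~ chain_cut u -> x u = shift s u.
Proof.
case: u => i e; rewrite /chain_cut /= negb_or !negb_and !negb_or => /andP[c1 c0].
rewrite /x /chain_rot -/h (@hfix i e) ?shiftE ?(@hfix i (e + s)) //; apply/implyP => /eqP E.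
- by move: c1; rewrite -E addrK eqxx /= andbF orbF -leqNgt.
- by move: c0; rewrite (_ : e = - s) ?eqxx /= ?andbF ?orbF -?leqNgt ?leqn0 //; apply/eqP; rewrite -addr_eq0 E.
- by move: c1; rewrite E eqxx /= orbF -leqNgt.
- by move: c0; rewrite E eqxx /= orbF -leqNgt leqn0.
Qed.

(** Since [s + t = 1], the face advances by 1 except at the cut points. The points 1 of all copies
    form one strand, the points [1 - s] another. The arcs from 2 to [- s] and from [2 - s] to 0
    descend the chain in alternation, so that each ends in one of these two strands. *)
Lemma chain_face (X : Type) (F : 'I_k.+1 * 'Z_N -> X) :
  (forall u, F (shift t (x u)) = F u) -> forall u, F u = F (ord0, 0).
Proof.
move=> FE.
have st : s + t = 1 by rewrite /t; ring.
have F1 (i : 'I_k.+1) : (i < k)%N -> F (i, 1) = F (inord i.+1, 1).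
  by move=> ik; rewrite -FE chain_rot1 // shiftE st.
have F0 (i : 'I_k.+1) : (0 < i)%N -> F (i, 0) = F (inord i.-1, 2%:R).
  by move=> ik; rewrite -FE chain_rot0 // shiftE -addrA st.
have F1s (i : 'I_k.+1) : (i < k)%N -> F (i, 1 - s) = F (inord i.+1, 1 - s).
  by move=> ik; rewrite -[LHS]FE chain_rot1s // shiftE add0r.
have FNs (i : 'I_k.+1) : (0 < i)%N -> F (i, - s) = F (inord i.-1, 2%:R - s).
  by move=> ik; rewrite -[LHS]FE chain_rotNs // shiftE /t addrA.
have Fstep i e : ~~ chain_cut (i, e) -> F (i, e) = F (i, e + 1).
  by move=> ie; rewrite -FE chain_rot_shift // !shiftE -addrA st.
have [q qE] : exists q, q = (N - s')%N by exists (N - s')%N.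
have NsE : - s = q%:R by rewrite qE natrB ?pchar_Zp ?sub0r //; nat_lia.
have sE : 1 - s = q.+1%:R by rewrite addrC NsE natr1.
have s2E : 2%:R - s = q.+2%:R by rewrite addrC NsE -natrD addnC.
have step i r : (1 < r < N)%N -> r != q -> r != q.+1 -> F (i, r%:R) = F (i, r.+1%:R).
  case/andP=> r_gt1 rN r1 r2.
  have ne v : (v < N)%N -> r != v -> (r%:R == v%:R :> 'Z_N) = false.
    by move=> vN /eqP rv; apply/eqP => /(Zp_natr_inj N_gt1 rN vN).
  have n1 : (r%:R == 1 :> 'Z_N) = false by apply: (ne 1%N); nat_lia.
  have n0 : (r%:R == 0 :> 'Z_N) = false by apply: (ne 0%N); nat_lia.
  have n2 : (r%:R == q%:R :> 'Z_N) = false by apply: ne => //; nat_lia.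
  have n3 : (r%:R == q.+1%:R :> 'Z_N) = false by apply: ne => //; nat_lia.
  by rewrite -natr1 -Fstep // cutE sE NsE n1 n0 n2 n3 !andbF.
have arc2 i r : (1 < r <= q)%N -> F (i, r%:R) = F (i, 2%:R).
  elim: r => // r IH rN; case: (eqVneq r 1%N) => [-> //|r1].
  by rewrite -step ?IH //; nat_lia.
have arc4 i r : (q + 2 <= r <= N)%N -> F (i, r%:R) = F (i, 2%:R - s).
  rewrite s2E; elim: r => [|r IH] rN; first nat_lia.
  case: (eqVneq r q.+1) => [-> //|r1].
  by rewrite -step ?IH //; nat_lia.
have G2 i : F (i, - s) = F (i, 2%:R) by rewrite NsE arc2 //; nat_lia.
have G4 i : F (i, 0) = F (i, 2%:R - s) by rewrite -(arc4 i N) ?pchar_Zp //; nat_lia.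
have I1 j : (j < k)%N -> inord (inord j : 'I_k.+1).+1 = inord j.+1 :> 'I_k.+1.
  by move=> jk; congr inord; rewrite inordK //; nat_lia.
have P1 j : (j <= k)%N -> F (inord j, 1) = F (inord 0, 1).
  elim: j => // j IH jk; rewrite -IH; last nat_lia.
  by rewrite [RHS]F1 ?I1 // inordK //; nat_lia.
have Q1 j : (j <= k)%N -> F (inord j, 1 - s) = F (inord 0, 1 - s).
  elim: j => // j IH jk; rewrite -IH; last nat_lia.
  by rewrite [RHS]F1s ?I1 // inordK //; nat_lia.
have i0 : (inord 0 : 'I_k.+1) = 0%N :> nat by rewrite inordK.
have ik : (inord k : 'I_k.+1) = k :> nat by rewrite inordK.
have E0 : F (inord 0, 0) = F (inord 0, 1).
  rewrite Fstep ?add0r // cutE i0 ltnn andFb orbF; apply/nandP; right.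
  by rewrite ![0 == _]eq_sym (negPf one_neq0) (negPf (proj1 one_sub_s)).
have E2 : F (inord 0, 2%:R) = F (inord 0, 1 - s).
  rewrite -G2 Fstep 1?addrC // cutE i0 ltnn andFb orbF; apply/nandP; right.
  rewrite (negPf (proj2 opp_s)) orFb -{1}[- s]add0r (inj_eq (addIr _)) eq_sym.
  exact: one_neq0.
have D j : (j < k)%N ->
    F (inord j.+1, 0) = F (inord j, 2%:R) /\ F (inord j.+1, 2%:R) = F (inord j, 0).
  move=> jk; have ij : (inord j.+1 : 'I_k.+1) = j.+1 :> nat by rewrite inordK.
  split; first by rewrite F0 ij.
  by rewrite -G2 FNs ij // -G4.
have W j : (j <= k)%N -> F (inord j, 0) = F (inord 0, if odd j then 1 - s else 1) /\
    F (inord j, 2%:R) = F (inord 0, if odd j then 1 else 1 - s).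
  elim: j => [|j IH] jk /=; first by rewrite E0 E2.
  have [-> ->] := D j jk; have [-> ->] := IH (ltnW jk).
  by case: (odd j).
(* In the last copy, 1 is followed by 2, whose arc descends [k] copies. For [k] even it ends in the
   strand of [1 - s], so the two strands merge. *)
have PQ : F (inord 0, 1) = F (inord 0, 1 - s).
  have := (W k (leqnn k)).2; rewrite (negPf k_even) => <-; rewrite -(P1 k) // Fstep // cutE ik.
  rewrite ltnn andFb orFb (negPf one_neq0) orFb eq_sym; apply/nandP; right.
  exact: (proj2 opp_s).
have all0 (i : 'I_k.+1) : F (i, 0) = F (inord 0, 1) /\ F (i, 2%:R) = F (inord 0, 1).
  have := W i; rewrite -ltnS ltn_ord inord_val => /(_ isT)[-> ->].
  by case: (odd i).
have all1 (i : 'I_k.+1) : F (i, 1) = F (inord 0, 1).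
  by have := P1 i; rewrite -ltnS ltn_ord inord_val => ->.
have all1s (i : 'I_k.+1) : F (i, 1 - s) = F (inord 0, 1).
  by have := Q1 i; rewrite -ltnS ltn_ord inord_val => ->.
move=> [i e]; rewrite (all0 ord0).1 -(natr_Zp e).
have eN : (e < N)%N by have := ltn_ord e; rewrite [X in (_ < X)%N]Zp_cast.
move: (nat_of_ord e) eN => {e} n nN; case: (ltnP 1 n) => n1.
  case: (leqP n q) => n2; first by rewrite arc2 ?(all0 i).2 //; nat_lia.
  case: (eqVneq n q.+1) => [->|n3]; first by rewrite -sE.
  by rewrite arc4 -?G4 ?(all0 i).1 //; nat_lia.
by case: n n1 nN => [|[|//]] _ _; [apply: (all0 i).1 | apply: all1].
Qed.

Lemma chain_rot_cut u : (x u != shift s u) = chain_cut u.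
Proof.
case: u => i e; apply/idP/idP => [|]; first by apply: contraNT => /chain_rot_shift ->.
have ne : 1 + s != s by rewrite -subr_eq0 addrK one_neq0.
rewrite cutE => ce; apply/eqP => /(congr1 snd) E; move: ce E.
case/orP => /andP[ik /orP[]/eqP->].
- by rewrite chain_rot1 // => /eqP; rewrite eq_sym (negPf ne).
- by rewrite chain_rot1s // shiftE subrK => /eqP; rewrite eq_sym (negPf one_neq0).
- by rewrite chain_rot0 // shiftE add0r => /eqP; rewrite (negPf ne).
- by rewrite chain_rotNs // shiftE addNr => /eqP; rewrite (negPf one_neq0).
Qed.

(** Copy 0 has the cut points 1 and [1 - s], the last copy 0 and [- s], a middle copy all four.
    Comparing them shows that copy 0 is sent to itself with displacement 0. *)
Lemma chain_rigid (c : 'I_k.+1 * 'Z_N -> 'I_k.+1 * 'Z_N) :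
    s *+ 2 != 0 -> injective c -> (forall u, c (x u) = x (c u)) ->
    (forall i e, c (i, e) = ((c (i, 0)).1, e + (c (i, 0)).2)) ->
  exists u, c u = u.
Proof.
move=> s2 c_inj cx cE; pose kap i := (c (i, 0)).1; pose tau i := (c (i, 0)).2.
have {}cE i e : c (i, e) = (kap i, e + tau i) by rewrite cE.
have cc i e : chain_cut (kap i, e + tau i) = chain_cut (i, e).
  have cs u : c (shift s u) = shift s (c u).
    by case: u => j f; rewrite shiftE !cE shiftE addrAC.
  by rewrite -cE -!chain_rot_cut -cx -cs (inj_eq c_inj).
have ik : (inord k : 'I_k.+1) = k :> nat by rewrite inordK.
have i1 : (inord 1 : 'I_k.+1) = 1%N :> nat by rewrite inordK // ltnS ltnW.
have c01 : chain_cut (ord0, 1) by rewrite cutE (ltnW k_gt1) eqxx.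
have c0s : chain_cut (ord0, 1 - s) by rewrite cutE (ltnW k_gt1) eqxx orbT.
have [m0 m1 m2] : [/\ 1%:R != 0 :> 'Z_N, 2%:R != 0 :> 'Z_N & 3%:R != 0 :> 'Z_N].
  by split; apply: Zp_natr_neq0; nat_lia.
have m3 : 4%:R != 0 :> 'Z_N by apply: Zp_natr_neq0; nat_lia.
have k0 : (0 < k)%N by nat_lia.
have := cc ord0 1; have := cc ord0 (1 - s); rewrite c01 c0s.
have := ltn_ord (kap ord0); rewrite ltnS leq_eqVlt => /orP[/eqP kk|kk].
- rewrite !cutE kk ltnn k0 !andFb !orFb !andTb => /orP[] /eqP E1 /orP[] /eqP E2.
  + by apply: (ring_absurd _ s_neq0 E2 E1); ring.
  + by apply: (ring_absurd _ s2 E2 E1); ring.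
  (* Copy 0 goes to the last copy, displaced by [-1]. Then copy 1 goes to copy [k - 1], displaced by
     1, and both 2 and [2 - s] would be cut points there, which [N > 4] excludes. *)
  + have tN : tau ord0 = -1 by apply/eqP; rewrite -addr_eq0 addrC E2.
    have := cx (ord0, 1); rewrite chain_rot1 // !cE tN subrr chain_rot0 ?kk // => E.
    pose i : 'I_k.+1 := inord 1; pose j : 'I_k.+1 := inord k.-1.
    have kj : kap i = j := congr1 fst E.
    have sj : s + tau i = 1 + s := congr1 snd E.
    have ij : (i < k)%N by rewrite i1.
    have ti : tau i = 1 by apply: (addrI s); rewrite sj addrC.
    have := cc i 1; have := cc i (1 - s); rewrite kj ti !cutE ij !eqxx !orbT !andTb !orTb.
    have two (e : 'Z_N) : chain_cut (j, e) -> [|| e == 1, e == 1 - s, e == 0 | e == - s].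
      by rewrite cutE => /orP[] /andP[_] /orP[] ->; rewrite ?orbT.
    move=> /two c4 /two c2.
    case/or4P: c2 => /eqP c2.
    * by apply: (ring_absurd _ m0 c2 (erefl 0)); ring.
    * by apply: (ring_absurd _ s_neqN1 c2 (erefl 0)); ring.
    * by apply: (ring_absurd _ m1 c2 (erefl 0)); ring.
    case/or4P: c4 => /eqP c4.
    * by apply: (ring_absurd _ m2 c4 (esym c2)); ring.
    * by apply: (ring_absurd _ m0 c4 (erefl 0)); ring.
    * by apply: (ring_absurd _ m3 c4 (esym c2)); ring.
    * by apply: (ring_absurd _ m1 c4 (erefl 0)); ring.
  + by apply: (ring_absurd _ s_neq0 E2 E1); ring.
case: (posnP (kap ord0)) => kz.
- rewrite !cutE kk kz !ltnn !andFb !orbF !andTb => /orP[] /eqP E1 /orP[] /eqP E2.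
  + by apply: (ring_absurd _ s_neq0 E2 E1); ring.
  + by apply: (ring_absurd _ s2 E2 E1); ring.
  + exists (ord0, 0); rewrite cE; congr pair; first exact: val_inj.
    by apply: (addrI 1); rewrite add0r E2 addr0.
  + by apply: (ring_absurd _ s_neq0 E2 E1); ring.
(* A middle copy is cut at 0 and 1, so two cut points of copy 0 would differ by 1; but they differ
   by 0, [s] or [- s]. *)
move=> _ _; have := cc ord0 (- tau ord0); have := cc ord0 (1 - tau ord0).
rewrite addNr subrK !cutE kk kz !eqxx !orbT !andTb !orTb k0 ltnn !andFb !orbF.
move=> /esym/orP[]/eqP E1 /esym/orP[] /eqP E2.
- by apply: (ring_absurd _ m0 E1 E2); ring.
- by apply: (ring_absurd _ (proj1 one_sub_s) E1 E2); ring.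
- by apply: (ring_absurd _ s_neqN1 E1 E2); ring.
- by apply: (ring_absurd _ m0 E1 E2); ring.
Qed.

End Chain.

(** * Automorphisms are translations on each copy *)

Section Translation.
Variables (I : finType) (N a : nat) (s t : 'Z_N).
Variables (x : I * 'Z_N -> I * 'Z_N) (B : {set I * 'Z_N}).
Hypothesis N_gt1 : (1 < N)%N.
Hypothesis t_order : forall j, (0 < j < a)%N -> t *+ j != 0.
Hypothesis t_expo : t *+ a = 0.
Hypothesis a_gt0 : (0 < a)%N.
Hypothesis xB : forall u, u \notin B -> x u = shift s u.
Hypothesis st : s + t = 1.
Variables (beta gamma : 'Z_N).
Hypothesis B_sub : forall u, u \in B -> u.2 \in [:: beta; beta - s; gamma; gamma - s].
(** The two cosets compared contain at most four perturbed points together. For [a = 4], in [Z/12],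
    two of the three cosets contain at most one each, and three is still less than 4. *)
Hypothesis a_large : (4 < a)%N \/
  [/\ N = 12%N, a = 4%N, s = 4%:R &
      forall i, (#|B :&: coset_of_shift a t (i, 4%:R)| <= 1)%N /\
                (#|B :&: coset_of_shift a t (i, 8%:R)| <= 1)%N].
Variable c : I * 'Z_N -> I * 'Z_N.
Hypothesis c_inj : injective c.
Hypothesis cx : forall u, c (x u) = x (c u).
Hypothesis cy : forall u, c (shift t u) = shift t (c u).

Let D := displacement c.
Let Dt u j : D (u.1, u.2 + t *+ j) = D u := displacement_t cy u j.

(** As [s] is not a multiple of [t], the points [r] and [r - s] never share a coset; so each of the
    pairs given by [beta] and [gamma] meets it at most once. *)
Lemma card_defect_coset u : (forall j, s != t *+ j) ->
  (#|B :&: coset_of_shift a t u| <= 2)%N.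
Proof.
move=> st_ne.
have mem2 (r : 'Z_N) v w : v \in coset_of_shift a t u -> w \in coset_of_shift a t u ->
    v.2 = r -> w.2 = r - s -> False.
  move=> /imsetP[j _ ->] /imsetP[j' _ ->] /= <- E.
  have /negP[] := st_ne (j + (a - j'))%N; apply/eqP.
  rewrite mulrnDr mulrnBr ?t_expo ?sub0r; last exact/ltnW.
  move: (t *+ j') (t *+ j) E => p g E.
  by rewrite (_ : s = (u.2 + g) - (u.2 + p)); [ring | rewrite E; ring].
have card1 r : (#|[set v in coset_of_shift a t u | (v.2 == r) || (v.2 == (r - s)%R)]| <= 1)%N.
  apply/card_le1_eqP => v w; rewrite !inE => /andP[vO vr] /andP[wO wr].
  have uv : v.1 = w.1 by case/imsetP: vO => ? _ ->; case/imsetP: wO => ? _ ->.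
  case: v w vO wO vr wr uv => v1 v2 [w1 w2] /= vO wO vr wr ->; congr pair.
  case/orP: vr => /eqP v2E; case/orP: wr => /eqP w2E; rewrite ?v2E ?w2E //.
    by case: (mem2 r _ _ vO wO).
  by case: (mem2 r _ _ wO vO).
apply: (@leq_trans (#|[set v in coset_of_shift a t u | (v.2 == beta) || (v.2 == (beta - s)%R)]| +
  #|[set v in coset_of_shift a t u | (v.2 == gamma) || (v.2 == (gamma - s)%R)]|)); last first.
  by rewrite -[2%N]/(1 + 1)%N leq_add.
apply: leq_trans (leq_card_setU _ _); apply: subset_leq_card; apply/subsetP => v.
rewrite !inE => /andP[/B_sub]; rewrite !inE => /or4P[] -> -> /=; by rewrite ?orbT.
Qed.

(** If [s] is a multiple of [t], then so is [1 = s + t], and commuting with translation by [t]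
    suffices. Otherwise a unit step is a step [t] followed by a step [s], and [displacement_s]
    applies. *)
Lemma displacement_const i e : D (i, e) = D (i, 0).
Proof.
have [/existsP[j /eqP sj]|/existsPn sj] := boolP [exists j : 'I_a, s == t *+ j].
  rewrite -(natr_Zp e); elim: (nat_of_ord e) => [|n IH]; first by rewrite mulr0n.
  rewrite -IH -[RHS](Dt _ j.+1) -natr1 mulrS -sj; congr (D (_, _)).
  by rewrite /snd (addrC t) st.
have {}sj j : s != t *+ j.
  have -> : t *+ j = t *+ (j %% a).
    by rewrite [in LHS](divn_eq j a) mulrnDr mulnC mulrnA t_expo mul0rn add0r.
  exact: (sj (Ordinal (ltn_pmod j a_gt0))).
have small := card_defect_coset^~ sj.
case: a_large => [a4|[N12 a4 s4 one]].
  have Ds u : D (shift s u) = D u.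
    apply: (displacement_s t_order t_expo a_gt0 xB c_inj cx cy).
    by apply: leq_ltn_trans a4; rewrite -[4%N]/(2 + 2)%N leq_add.
  rewrite -(natr_Zp e); elim: (nat_of_ord e) => [|n IH]; first by rewrite mulr0n.
  rewrite -IH -natr1 -[RHS](Dt _ 1) -[RHS]Ds /shift; congr (D (_, _)).
  by rewrite /snd -addrA mulr1n (addrC t) st.
have Z12 : 12%:R = 0 :> 'Z_N by rewrite -[in 12%:R]N12 pchar_Zp.
have tE : t = 9%:R by move: st; rewrite s4 => /(canRL (addKr _)) ->; rewrite -[LHS]addr0 -Z12; ring.
have Ds (r : nat) : r = 4%N \/ r = 8%N -> D (i, r%:R) = D (i, (r + 4)%:R).
  move=> rE; rewrite natrD -s4.
  symmetry; apply: (@displacement_s _ _ _ _ _ _ _ t_order t_expo a_gt0 xB _ c_inj cx cy (i, r%:R)).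
  apply: (@leq_ltn_trans (1 + 2)); last by rewrite a4.
  by rewrite leq_add //; case: rE => ->; case: (one i).
have D4 := Ds _ (or_introl (erefl _)).
have D8 := Ds _ (or_intror (erefl _)).
have DE (r : nat) : (r < 3)%N -> D (i, (4 * r)%:R) = D (i, 0).
  by case: r => [|[|[|//]]] _ //; rewrite ?D4 ?D8 ?Z12.
rewrite -(natr_Zp e); have : (nat_of_ord e < 12)%N.
  by have := ltn_ord e; rewrite [X in (_ < X)%N]Zp_cast // => /leq_trans; apply; rewrite N12.
move: (nat_of_ord e) => {e} n n12.
(* Chinese remainders: modulo 12, [4 (n %% 3) + 9 (n %% 4)] is [13 n = n]. *)
rewrite -(DE (n %% 3)%N) ?ltn_mod // -[RHS](Dt _ (n %% 4)); congr (D (_, _)).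
have [m mE] : exists m, (4 * (n %% 3) + 9 * (n %% 4) = n + 12 * m)%N.
  by exists ((4 * (n %% 3) + 9 * (n %% 4) - n) %/ 12)%N; lia.
by rewrite tE -mulrnA -natrD mE natrD natrM Z12 mul0r addr0.
Qed.

End Translation.

(** Possible cut points are 0, 1, 8 and 9, and the cosets are the classes modulo 3: that of 4
    contains only 1 and that of 8 only 8. *)
Lemma chain_cut_coset_4_3 k (i : 'I_k.+1) (r : nat) : r = 4%N \/ r = 8%N ->
  (#|[set u : 'I_k.+1 * 'Z_12 | chain_cut 4 u] :&: coset_of_shift 4 (1 - 4%:R)%R (i, r%:R)| <= 1)%N.
Proof.
move=> rE; apply/card_le1_eqP.
suff eq v : v \in [set u : 'I_k.+1 * 'Z_12 | chain_cut 4 u] :&: coset_of_shift 4 (1 - 4%:R)%R (i, r%:R) ->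
    v = (i, if r == 4%N then 1 else 8%:R) by move=> v w /eq-> /eq->.
rewrite !inE => /andP[vB /imsetP[j _ vE]]; rewrite vE; congr pair.
have {vB}: v.2 \in [:: 1; 1 - 4%:R; 0; - 4%:R].
  by rewrite !inE; case/orP: vB => /andP[_ /orP[] ->]; rewrite ?orbT.
rewrite vE /snd; case: j {vE} => [[|[|[|[|//]]]] jlt]; case: rE => -> vB.
all: try by apply: val_inj.
all: by exfalso; move: vB; apply/negP.
Qed.

Lemma rigid_chain (k N a b s' : nat) (s := s'%:R : 'Z_N) (t := 1 - s) :
    ~~ odd k -> (1 < k)%N -> (4 < N)%N -> (1 < s' < N.-1)%N ->
    (2 < b)%N -> (forall j, (0 < j < b)%N -> s *+ j != 0) -> s *+ b = 0 ->
    (forall j, (0 < j < a)%N -> t *+ j != 0) -> t *+ a = 0 ->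
    (4 < a)%N \/ [/\ N = 12%N, a = 4%N & s' = 4%N] ->
  rigid_dessin_type (k.+1 * N) b a (k.+1 * N).
Proof.
move=> k_even k_gt1 N_gt4 s'_range b_gt2 s_order s_expo t_order t_expo a_large.
have N_gt1 : (1 < N)%N by lia.
have a_gt0 : (0 < a)%N by case: a_large => [|[_ -> _]]; lia.
pose x : 'I_k.+1 * 'Z_N -> 'I_k.+1 * 'Z_N := chain_rot s'.
pose B := [set u : 'I_k.+1 * 'Z_N | chain_cut s' u].
have xK := chain_swapK k_even k_gt1 N_gt4 s'_range.
apply: (@rigid_dessin_fun _ x (shift t) a b _ (ord0, 0)).
- by rewrite card_prod !card_ord [X in (_ * X)%N]Zp_cast.
- exact: a_gt0.
- exact: ltn_trans b_gt2.
- by move=> u; rewrite iter_chain_rot // iter_shift s_expo addr0 -surjective_pairing xK.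
- move=> j u jb; rewrite iter_chain_rot // iter_shift; apply: contraNneq (s_order _ jb).
  move=> /(congr1 (@chain_swap k N)); rewrite xK; case: (chain_swap u) => i e /(congr1 snd) /= E.
  by apply/eqP; apply: (addrI e); rewrite E addr0.
- by move=> u; rewrite iter_shift t_expo addr0 -surjective_pairing.
- move=> j u ja; rewrite iter_shift; apply: contraNneq (t_order _ ja).
  case: u => i e /(congr1 snd) /= E.
  by apply/eqP; apply: (addrI e); rewrite E addr0.
- by move=> F FE; apply: (chain_face k_even k_gt1 N_gt4 s'_range).
move=> c c_inj cx cy.
have xB u : u \notin B -> x u = shift s u by rewrite inE; apply: chain_rot_shift.
have Bsub u : u \in B -> u.2 \in [:: 0; 0 - s; 1; 1 - s].
  by rewrite !inE sub0r => /orP[] /andP[_ /orP[] ->]; rewrite ?orbT.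
have st : s + t = 1 by rewrite /t; ring.
have a_large' : (4 < a)%N \/ [/\ N = 12%N, a = 4%N, s = 4%:R &
      forall i, (#|B :&: coset_of_shift a t (i, 4%:R)| <= 1)%N /\
                (#|B :&: coset_of_shift a t (i, 8%:R)| <= 1)%N].
  case: a_large => [?|[N12 a4 s4]]; [by left | right].
  rewrite /B /t /s s4 a4; split=> // i; clear -N12; subst N.
  by split; apply: chain_cut_coset_4_3; [left | right].
have const := displacement_const N_gt1 t_order t_expo a_gt0 xB st Bsub a_large' c_inj cx cy.
apply: (chain_rigid k_even k_gt1 N_gt4 s'_range) => //; first exact: s_order.
move=> i e; have := const i e; rewrite /displacement subr0 => -[<- <-].
by rewrite addrC subrK -surjective_pairing.
Qed.

(** * A single twisted copy of Z/N *)

Section TwistedRot.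
Variables (N m : nat) (s : 'Z_N).
Hypotheses (m_gt0 : (0 < m)%N) (mN : (m.*2.+2 < N)%N).
Hypothesis sE : s = m%:R \/ s = - m%:R.
Let t : 'Z_N := 1 - s.
Let N_gt1 : (1 < N)%N. Proof. by nat_lia. Qed.

(* With [h] exchanging [twist_base] and [twist_base + m + 1], the edges where *)
(* [h \o (+ s) \o h] differs from [+ s] are the same for [s = m], [s = - m]. *)
Definition twist_base : 'Z_N := if s == m%:R then m%:R else 0.
Let alpha := twist_base.
Let alpha' := alpha + m.+1%:R.

Let h : {perm 'Z_N} := tperm alpha alpha'.
Definition twisted_rot (u : unit * 'Z_N) : unit * 'Z_N := (u.1, h (h u.2 + s)).
Let x := twisted_rot.

Definition twist_defect : seq 'Z_N := [:: 0; m%:R; m.+1%:R; m.*2.+1%:R].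

Let nat_mem r : (r < N)%N -> (r%:R \in twist_defect) = (r \in [:: 0; m; m.+1; m.*2.+1])%N.
Proof.
have eq v : (r < N)%N -> (v < N)%N -> (r%:R == v%:R :> 'Z_N) = (r == v).
  by move=> rN vN; apply/eqP/eqP => [/(Zp_natr_inj N_gt1 rN vN)|->].
move=> rN; rewrite !inE -!eq //; nat_lia.
Qed.

Let N_neq0 r : (0 < r < N)%N -> r%:R != 0 :> 'Z_N.
Proof. exact: Zp_natr_neq0. Qed.

Let alphaE : (s = m%:R /\ alpha = m%:R) \/ (s = - m%:R /\ alpha = 0).
Proof.
rewrite /alpha /twist_base; case: eqP => [->|ne]; [by left | right].
by case: sE.
Qed.

Let defect e : (e \in twist_defect) = [|| e == alpha, e == alpha', e == alpha - s | e == alpha' - s].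
Proof.
have m2 : m.*2.+1%:R = m%:R + m.+1%:R :> 'Z_N by rewrite -natrD addnS addnn.
rewrite !inE m2 /alpha'; case: alphaE => -[-> ->].
  rewrite subrr (_ : m%:R + m.+1%:R - m%:R = m.+1%:R); last by ring.
  by move: (e == 0) (e == m%:R) (e == m.+1%:R) (e == m%:R + m.+1%:R) => [] [] [] [].
rewrite !add0r opprK (addrC m.+1%:R).
by move: (e == 0) (e == m%:R) (e == m.+1%:R) (e == m%:R + m.+1%:R) => [] [] [] [].
Qed.

Lemma iter_twisted_rot j u : iter j x u = (u.1, h (h u.2 + s *+ j)).
Proof.
elim: j => [|j IH] /=; first by rewrite mulr0n addr0 tpermK; case: u.
by rewrite IH /x /twisted_rot /= tpermK -addrA -mulrSr.
Qed.

Let ne_alpha : [/\ alpha' != alpha, alpha' + s != alpha & alpha' - s != alpha].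
Proof.
have m2 : m.*2.+1%:R = m.+1%:R + m%:R :> 'Z_N by rewrite -natrD addSn addnn.
have m1 : 1%:R = m.+1%:R - m%:R :> 'Z_N by rewrite -natrB // subSnn.
have n1 : 1%:R != 0 :> 'Z_N by apply: N_neq0; nat_lia.
have n2 : m.*2.+1%:R != 0 :> 'Z_N by apply: N_neq0; nat_lia.
have n3 : m.+1%:R != 0 :> 'Z_N by apply: N_neq0; nat_lia.
have aE r : (alpha + m.+1%:R + r != alpha) = (m.+1%:R + r != 0).
  by rewrite -subr_eq0; congr (_ != 0); ring.
split; rewrite /alpha' ?aE //.
- by rewrite -[alpha + _]addr0 aE addr0.
- by case: alphaE => -[-> _]; rewrite -?m1 -?m2.
- by case: alphaE => -[-> _]; rewrite ?opprK -?m1 -?m2.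
Qed.

Let s_neq0 : s != 0.
Proof.
have : m%:R != 0 :> 'Z_N by apply: N_neq0; nat_lia.
by case: sE => ->; rewrite ?oppr_eq0.
Qed.

Let h_fix e : e != alpha -> e != alpha' -> h e = e.
Proof. by move=> *; rewrite tpermD // eq_sym. Qed.

Lemma twisted_rot_shift u : u.2 \notin twist_defect -> x u = shift s u.
Proof.
case: u => i e; rewrite defect !negb_or /snd => /and4P[e1 e2 e3 e4].
have eE z : (e + s == z) = (e == z - s) by rewrite eq_sym -subr_eq eq_sym.
by rewrite /x /twisted_rot /shift /fst /snd [h e]h_fix // h_fix // eE.
Qed.

Let ha : h alpha = alpha'. Proof. exact: tpermL. Qed.
Let ha' : h alpha' = alpha. Proof. exact: tpermR. Qed.

Let xE v e : x (v, e) = (v, h (h e + s)).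
Proof. by []. Qed.

Let twisted_rot_alpha v : x (v, alpha) = (v, alpha' + s).
Proof.
case: ne_alpha => _ n1 _; rewrite xE ha h_fix //.
by rewrite -subr_eq0 addrAC subrr add0r.
Qed.

Let twisted_rot_alpha' v : x (v, alpha') = (v, alpha + s).
Proof.
case: ne_alpha => _ _ n2; rewrite xE ha' h_fix //.
  by rewrite -subr_eq0 addrAC subrr add0r.
by apply: contraNneq n2 => <-; rewrite addrK.
Qed.

Let twisted_rot_alpha_s v : x (v, alpha - s) = (v, alpha').
Proof.
case: ne_alpha => _ n1 _; rewrite xE [h (alpha - s)]h_fix.
- by rewrite subrK ha.
- by rewrite -subr_eq0 addrAC subrr add0r oppr_eq0.
by apply: contraNneq n1 => <-; rewrite subrK.
Qed.

Let twisted_rot_alpha'_s v : x (v, alpha' - s) = (v, alpha).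
Proof.
case: ne_alpha => _ _ n2; rewrite xE [h (alpha' - s)]h_fix //.
  by rewrite subrK ha'.
by rewrite -subr_eq0 addrAC subrr add0r oppr_eq0.
Qed.

Lemma twisted_rot_defect u : (x u != shift s u) = (u.2 \in twist_defect).
Proof.
apply/idP/idP; first by apply: contraNT => /twisted_rot_shift ->.
have [n0 _ _] := ne_alpha; have shE v e : shift s (v, e) = (v, e + s) :> unit * 'Z_N by [].
case: u => v e; rewrite defect /snd => /or4P[] /eqP-> ; apply/eqP.
- by rewrite twisted_rot_alpha shE => /(congr1 snd)/addIr/eqP; apply/negP.
- by rewrite twisted_rot_alpha' shE => /(congr1 snd)/addIr/esym/eqP; apply/negP.
- by rewrite twisted_rot_alpha_s shE subrK => /(congr1 snd)/eqP; apply/negP.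
- by rewrite twisted_rot_alpha'_s shE subrK => /(congr1 snd)/esym/eqP; apply/negP.
Qed.

(** The perturbed points cut [Z/N] into the arcs [1 .. m], [m + 1], [m + 2 .. 2 m + 1] and
    [2 m + 2 .. N]. The face visits them as first, fourth, third, second, and returns to the
    first. *)
Lemma twisted_rot_face (X : Type) (F : unit * 'Z_N -> X) :
  (forall u, F (shift t (x u)) = F u) -> forall u, F u = F (tt, 0).
Proof.
move=> FE.
have st : s + t = 1 by rewrite /t; ring.
have shE v e : shift t (v, e) = (v, e + t) :> unit * 'Z_N by [].
have J1 : F (tt, alpha) = F (tt, alpha' + 1) by rewrite -FE twisted_rot_alpha shE -addrA st.
have J2 : F (tt, alpha') = F (tt, alpha + 1) by rewrite -[LHS]FE twisted_rot_alpha' shE -addrA st.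
have J3 : F (tt, alpha - s) = F (tt, alpha' - s + 1).
  by rewrite -[LHS]FE twisted_rot_alpha_s shE; congr (F (_, _)); rewrite -st; ring.
have J4 : F (tt, alpha' - s) = F (tt, alpha - s + 1).
  by rewrite -[LHS]FE twisted_rot_alpha'_s shE; congr (F (_, _)); rewrite -st; ring.
pose G (r : nat) := F (tt, r%:R).
have [G0 G1 Gm Gm1] : [/\ G 0%N = G m.+2, G m.+1 = G 1%N, G m = G m.*2.+2 & G m.*2.+1 = G m.+1].
  have E1 : m.+2%:R = m.+1%:R + 1 :> 'Z_N by rewrite natr1.
  have E2 : m.*2.+2%:R = m%:R + m.+1%:R + 1 :> 'Z_N by rewrite -natrD natr1 addnS addnn.
  have E3 : m.*2.+1%:R = m%:R + m.+1%:R :> 'Z_N by rewrite -natrD addnS addnn.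
  rewrite /G E1 E2 E3; move: J1 J2 J3 J4; rewrite /alpha'.
  case: alphaE => -[-> ->].
    rewrite subrr (_ : m%:R + m.+1%:R - m%:R = m.+1%:R); last by ring.
    by rewrite add0r (natr1 m) => *; split.
  by rewrite !add0r opprK (natr1 m) (addrC m%:R) => *; split.
have Gstep r : (r < N)%N -> r \notin [:: 0; m; m.+1; m.*2.+1]%N -> G r = G r.+1.
  move=> rN rm; rewrite /G -natr1 -FE twisted_rot_shift /snd ?nat_mem // /shift.
  by rewrite /fst /snd -addrA st.
have arc1 r : (0 < r <= m)%N -> G r = G 1%N.
  elim: r => // r IH rm; case: (posnP r) => [->//|r0].
  by rewrite -Gstep ?IH // ?inE; nat_lia.
have arc2 r : (m.*2.+2 <= r <= N)%N -> G r = G m.*2.+2.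
  elim: r => // r IH rm; case: (eqVneq r m.*2.+1) => [->//|r0].
  by rewrite -Gstep ?IH // ?inE; nat_lia.
have arc3 r : (m.+2 <= r <= m.*2.+1)%N -> G r = G m.+2.
  elim: r => // r IH rm; case: (eqVneq r m.+1) => [->//|r0].
  by rewrite -Gstep ?IH // ?inE; nat_lia.
have GN : G N = G 0%N by rewrite /G pchar_Zp.
have Em : G m = G 1%N by rewrite arc1 // m_gt0 /=.
have EN : G 0%N = G 1%N by rewrite -GN arc2 -?Gm //; nat_lia.
have E2 : G m.+2 = G 1%N by rewrite -G0.
case=> -[] e; rewrite -(natr_Zp e) -/(G 0%N) -/(G _) EN.
have eN : (e < N)%N by have := ltn_ord e; rewrite [X in (_ < X)%N]Zp_cast.
move: (nat_of_ord e) eN => {e} r rN.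
case: (posnP r) => [-> //|r0].
case: (leqP r m) => r1; first by rewrite arc1 ?r0.
case: (eqVneq r m.+1) => [-> //|r2].
case: (leqP r m.*2.+1) => r3; first by rewrite arc3 //; nat_lia.
by rewrite arc2 -?Gm //; nat_lia.
Qed.

(** The gaps between consecutive perturbed points are [m], 1, [m] and [N - 2 m - 1]. A nontrivial
    rotation preserving them would force [N = 2 m + 2]. *)
Lemma twisted_rot_rigid (c : unit * 'Z_N -> unit * 'Z_N) : (4 < N)%N ->
    injective c -> (forall u, c (x u) = x (c u)) ->
    (forall v e, c (v, e) = ((c (v, 0)).1, e + (c (v, 0)).2)) ->
  exists u, c u = u.
Proof.
move=> N_gt4 c_inj cx cE; pose tau := (c (tt, 0)).2.
have {}cE v e : c (v, e) = (tt, e + tau) by rewrite cE /tau; case: v; case: (c _) => -[].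
have ce e : (e + tau \in twist_defect) = (e \in twist_defect).
  have cs u : c (shift s u) = shift s (c u) by case: u => v f; rewrite /shift !cE addrAC.
  by rewrite -(twisted_rot_defect (tt, e)) -(inj_eq c_inj) cx cs twisted_rot_defect cE.
exists (tt, 0); rewrite cE add0r; congr pair; apply/eqP/negPn/negP => tau0.
move: (ce); rewrite -(natr_Zp tau).
have tN : (tau < N)%N by have := ltn_ord tau; rewrite [X in (_ < X)%N]Zp_cast.
have : nat_of_ord tau != 0%N by apply: contraNneq tau0 => E; apply/eqP/val_inj.
move: (nat_of_ord tau) tN => {ce tau0} r rN r0 {}ce.
have {}ce v : (v < N)%N -> (v + r < N)%N /\ (v + r \in [:: 0; m; m.+1; m.*2.+1])%N = (v \in [:: 0; m; m.+1; m.*2.+1])%N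
   \/ (N <= v + r)%N /\ (v + r - N \in [:: 0; m; m.+1; m.*2.+1])%N = (v \in [:: 0; m; m.+1; m.*2.+1])%N.
  move=> vN; case: (ltnP (v + r) N) => vr; [left | right]; split=> //.
    by rewrite -!nat_mem // natrD ce.
  rewrite -!nat_mem //; last by nat_lia.
  by rewrite natrB // pchar_Zp // subr0 natrD ce.
have N0 : (0 < N)%N by nat_lia.
have N1 : (m < N)%N by nat_lia.
have N2 : (m.+1 < N)%N by nat_lia.
have N3 : (m.*2.+1 < N)%N by nat_lia.
move: (ce 0%N N0) (ce m N1) (ce m.+1 N2) (ce m.*2.+1 N3).
rewrite !inE !add0n !eqxx !orbT => -[[_ E]|[] //]; last by nat_lia.
move: E; rewrite (negPf r0) orFb => /or3P[] /eqP rE; subst r.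
- move=> m_r _ m2_r; have m1 : m = 1%N by nat_lia.
  by move: m2_r mN; rewrite m1; nat_lia.
- by move=> _ m1_r _; nat_lia.
move=> m_r m1_r _; have NE : N = (3 * m + 1)%N by nat_lia.
by nat_lia.
Qed.

End TwistedRot.

Lemma twist_defect_coset_4_3 (r : nat) : r = 4%N \/ r = 8%N ->
  (#|[set u : unit * 'Z_12 | u.2 \in twist_defect 12 4] :&:
     coset_of_shift 4 (1 - 4%:R)%R (tt, r%:R)| <= 1)%N.
Proof.
move=> rE; apply/card_le1_eqP.
suff eq v : v \in [set u : unit * 'Z_12 | u.2 \in twist_defect 12 4] :&:
      coset_of_shift 4 (1 - 4%:R)%R (tt, r%:R) ->
    v = (tt, if r == 4%N then 4%:R else 5%:R) by move=> v w /eq-> /eq->.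
rewrite inE [v \in [set _ | _]]inE => /andP[vB /imsetP[j _ vE]]; move: vB; rewrite vE.
rewrite /snd; case: j {vE} => [[|[|[|[|//]]]] jlt]; case: rE => -> vB; congr pair.
all: try by apply: val_inj.
all: by exfalso; move: vB; apply/negP.
Qed.

Lemma rigid_twisted (N a b m : nat) (s : 'Z_N) (t := 1 - s) :
    (0 < m)%N -> (m.*2.+2 < N)%N -> s = m%:R \/ s = - m%:R ->
    (0 < b)%N -> (forall j, (0 < j < b)%N -> s *+ j != 0) -> s *+ b = 0 ->
    (forall j, (0 < j < a)%N -> t *+ j != 0) -> t *+ a = 0 ->
    (4 < a)%N \/ [/\ N = 12%N, a = 4%N, m = 4%N & s = 4%:R] ->
  rigid_dessin_type N b a N.
Proof.
move=> m_gt0 mN sE b_gt0 s_order s_expo t_order t_expo a_large.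
have N_gt4 : (4 < N)%N by lia.
have N_gt1 : (1 < N)%N by lia.
have a_gt0 : (0 < a)%N by case: a_large => [|[_ -> _]]; lia.
pose x : unit * 'Z_N -> unit * 'Z_N := twisted_rot m s.
pose B := [set u : unit * 'Z_N | u.2 \in twist_defect N m].
apply: (@rigid_dessin_fun _ x (shift t) a b _ (tt, 0)).
- by rewrite card_prod card_unit card_ord mul1n Zp_cast.
- exact: a_gt0.
- exact: b_gt0.
- by move=> -[[] e]; rewrite iter_twisted_rot // s_expo addr0 tpermK.
- move=> j [v e] jb; rewrite iter_twisted_rot //; apply: contraNneq (s_order _ jb).
  set g := tperm _ _; move=> /(congr1 (g \o snd)) /=; rewrite tpermK => E.
  by apply/eqP; apply: (addrI (g e)); rewrite addr0.
- by move=> -[[] e]; rewrite iter_shift t_expo addr0.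
- move=> j [v e] ja; rewrite iter_shift; apply: contraNneq (t_order _ ja) => /(congr1 snd) /= E.
  by apply/eqP; apply: (addrI e); rewrite E addr0.
- by move=> F FE; apply: (@twisted_rot_face N m s).
move=> c c_inj cx cy.
have xB u : u \notin B -> x u = shift s u.
  by rewrite inE; apply: twisted_rot_shift.
have m2 : m.*2.+1%:R = m%:R + m.+1%:R :> 'Z_N by rewrite -natrD addnS addnn.
pose beta : 'Z_N := if s == m%:R then m%:R else 0.
have Bsub u : u \in B -> u.2 \in [:: beta; beta - s; beta + m.+1%:R; beta + m.+1%:R - s].
  rewrite !inE m2 /beta; case: (s =P m%:R) => [->|ne].
    rewrite subrr (_ : m%:R + m.+1%:R - m%:R = m.+1%:R); last by ring.
    by move: (_ == 0) (_ == m%:R) (_ == m.+1%:R) (_ == _ + _) => [] [] [] [].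
  case: sE => // ->; rewrite !add0r !opprK (addrC m.+1%:R).
  by move: (_ == 0) (_ == m%:R) (_ == m.+1%:R) (_ == _ + _) => [] [] [] [].
have st : s + t = 1 by rewrite /t; ring.
have a_large' : (4 < a)%N \/ [/\ N = 12%N, a = 4%N, s = 4%:R &
      forall i, (#|B :&: coset_of_shift a t (i, 4%:R)| <= 1)%N /\
                (#|B :&: coset_of_shift a t (i, 8%:R)| <= 1)%N].
  case: a_large => [?|[N12 a4 m4 s4]]; [by left | right].
  rewrite /B /t s4 a4 m4; split=> // -[]; clear -N12; subst N.
  by split; apply: twist_defect_coset_4_3; [left | right].
have const := displacement_const N_gt1 t_order t_expo a_gt0 xB st Bsub a_large' c_inj cx cy.
apply: (twisted_rot_rigid m_gt0 mN sE) => // i e.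
have := const i e; rewrite /displacement subr0 => -[<- <-].
by rewrite addrC subrK -surjective_pairing.
Qed.

(** * Choice of the translations *)

Lemma Zp_natr_eq0 (N m : nat) : (1 < N)%N -> (m%:R == 0 :> 'Z_N) = (N %| m)%N.
Proof. by move=> N1; rewrite -val_eqE /= val_Zp_nat. Qed.

Lemma Zp_natr_order (N q b v j : nat) : (1 < N)%N -> N = (q * b)%N -> coprime v b ->
  ((q * v)%:R *+ j == 0 :> 'Z_N) = (b %| j)%N.
Proof.
move=> N1 NE co; have q0 : (0 < q)%N by case: q NE N1 => // ->.
by rewrite -mulrnA Zp_natr_eq0 // NE -mulnA dvdn_pmul2l // Gauss_dvdr // coprime_sym.
Qed.

Lemma dvdz_primeM (r : nat) (x y : int) : prime r ->
  (r %| x * y)%Z = (r %| x)%Z || (r %| y)%Z.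
Proof. by move=> pr; rewrite !dvdzE abszM /= Euclid_dvdM. Qed.

(* The candidates are [j = 0, 1, 2]: [r] divides each of the two terms for at *)
(* most one of them, and at most one term can vanish mod [r] when [r = 2].    *)
Lemma bezout_avoid_prime (r : nat) (p q x y M : int) :
    prime r -> q * x + p * y = 1 -> ~~ (r %| M)%Z -> (r = 2%N -> (r %| p * q)%Z) ->
  exists j : int, ~~ (r %| x + p * (j * M))%Z && ~~ (r %| y - q * (j * M))%Z.
Proof.
move=> pr E rM r2.
have r_not1 : (r %| (1 : int))%Z = false by rewrite dvdzE /= dvdn1; case: r pr {rM r2} => [|[]].
have px : (r %| p)%Z -> forall j, (r %| x + p * (j * M))%Z = false.
  move=> rp j; apply: contraFF r_not1 => rx.
  have {}rx : (r %| x)%Z by rewrite -[x](addrK (p * (j * M))) rpredB // dvdz_mulr.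
  by rewrite -E; apply: rpredD; [apply: dvdz_mull | apply: dvdz_mulr].
have qy : (r %| q)%Z -> forall j, (r %| y - q * (j * M))%Z = false.
  move=> rq j; apply: contraFF r_not1 => ry.
  have {}ry : (r %| y)%Z by rewrite -[y](subrK (q * (j * M))) rpredD // dvdz_mulr.
  by rewrite -E; apply: rpredD; [apply: dvdz_mulr | apply: dvdz_mull].
have diff (j j' : int) : (r %| x + p * (j * M))%Z -> (r %| x + p * (j' * M))%Z ->
    (r %| j' - j)%Z.
  move=> d1 d2; have : (r %| p * ((j' - j) * M))%Z.
    by rewrite (_ : _ * _ = (x + p * (j' * M)) - (x + p * (j * M))); [rewrite rpredB | ring].
  rewrite !dvdz_primeM // (negPf rM) orbF => /orP[/px E'|//].
  by rewrite E' in d1.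
have diff' (j j' : int) : (r %| y - q * (j * M))%Z -> (r %| y - q * (j' * M))%Z ->
    (r %| j' - j)%Z.
  move=> d1 d2; have : (r %| q * ((j' - j) * M))%Z.
    by rewrite (_ : _ * _ = (y - q * (j * M)) - (y - q * (j' * M))); [rewrite rpredB | ring].
  rewrite !dvdz_primeM // (negPf rM) orbF => /orP[/qy E'|//].
  by rewrite E' in d1.
have [rp|rp] := boolP (r %| p)%Z.
  have [ry|ry] := boolP (r %| y - q * (0 * M))%Z; last by exists 0; rewrite px ?ry.
  exists 1; rewrite px //=; apply/negP => ry'.
  by have := diff' _ _ ry ry'; rewrite subr0 r_not1.
have [rq|rq] := boolP (r %| q)%Z.
  have [rx|rx] := boolP (r %| x + p * (0 * M))%Z; last by exists 0; rewrite qy ?rx.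
  exists 1; rewrite qy // andbT; apply/negP => rx'.
  by have := diff _ _ rx rx'; rewrite subr0 r_not1.
have n3 : (r %| (2 : int))%Z = false.
  apply/negP => /= r_2; have rE : r = 2%N.
    by apply/eqP; move: r_2; rewrite dvdzE /= dvdn_prime2.
  by have := r2 rE; rewrite dvdz_primeM // (negPf rp) (negPf rq).
pose bad j := (r %| x + p * (j * M))%Z; pose bad' j := (r %| y - q * (j * M))%Z.
have H j j' : (r %| j' - j)%Z = false -> ~~ (bad j && bad j') /\ ~~ (bad' j && bad' j').
  by move=> jj; split; apply/negP => /andP[b1 b2]; [move: (diff _ _ b1 b2) | move: (diff' _ _ b1 b2)]; rewrite jj.
have [] := H 0 1; rewrite ?subr0 //; have [] := H 0 2; rewrite ?subr0 //; have [] := H 1 2 => //.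
case: (boolP (~~ bad 0 && ~~ bad' 0)) => [|b0]; first by exists 0.
case: (boolP (~~ bad 1 && ~~ bad' 1)) => [|b1]; first by exists 1.
case: (boolP (~~ bad 2 && ~~ bad' 2)) => [|b2]; first by exists 2.
by move: b0 b1 b2; case: (bad 0); case: (bad 1); case: (bad 2); case: (bad' 0); case: (bad' 1); case: (bad' 2).
Qed.

(** Primes are treated one at a time: changing the pair by multiples of the product [M] of those
    already treated keeps them coprime to [x'] and [y']. *)
Lemma bezout_avoid_primes (rs : seq nat) (p q x y : int) :
    uniq rs -> all prime rs -> q * x + p * y = 1 ->
    (2%N \in rs -> (2 %| p * q)%Z) ->
  exists x' y' : int, q * x' + p * y' = 1 /\
    {in rs, forall r : nat, ~~ (r %| x')%Z && ~~ (r %| y')%Z}.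
Proof.
move=> + + E; elim: rs => [|r rs IH] /=; first by exists x, y.
move=> /andP[r_rs rs_u] /andP[pr prs] r2.
have [|x' [y' [E' good]]] := IH rs_u prs; first by move=> rs2; rewrite r2 // inE rs2 orbT.
pose M := (\prod_(l <- rs) l)%N.
have rM : ~~ (r %| (M : int))%Z.
  rewrite dvdzE /= Euclid_dvd_prod // big_has; apply/hasPn => l lrs.
  rewrite dvdn_prime2 //; last exact: (allP prs).
  by apply: contraNneq r_rs => ->.
have lM l : l \in rs -> (l %| (M : int))%Z by move=> lrs; rewrite dvdzE /= /M (big_rem l) //= dvdn_mulr.
have [|j /andP[jx jy]] := @bezout_avoid_prime r p q x' y' M pr E' rM.
  by move=> r2'; move: r2; rewrite r2' inE eqxx; apply.
exists (x' + p * (j * M)), (y' - q * (j * M)); split; first by rewrite -E'; ring.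
move=> l; rewrite inE => /predU1P[-> | lrs]; first by rewrite jx jy.
have /andP[lx ly] := good l lrs.
have ld z : (l %| z * (j * M))%Z by rewrite mulrA dvdz_mull // lM.
apply/andP; split.
  by apply: contra lx => lx; rewrite -[x'](addrK (p * (j * M))) rpredB.
by apply: contra ly => ly; rewrite -[y'](subrK (q * (j * M))) rpredD.
Qed.

(* Makes [s = q x] and [t = p y] of orders [d p] and [d q] in [Z/(d p q)]. *)
Lemma coprime_bezout_split (d p q : nat) :
    (0 < d)%N -> (0 < p)%N -> (0 < q)%N -> coprime p q -> odd (d * p * q + p + q) ->
  exists x y : nat, [/\ (x < d * p)%N, (q * x + p * y = 1 %[mod d * p * q])%N,
    coprime x (d * p) & coprime y (d * q)].
Proof.
move=> d0 p0 q0 pq odd_pq.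
have [x0 [y0 E0]] : exists x0 y0 : int, (q : int) * x0 + (p : int) * y0 = 1.
  have /eqP := pq; have := Bezoutz q p => -[u [v E]] pq1.
  by exists u, v; rewrite mulrC (mulrC p%:Z) E /gcdz /= gcdnC pq1.
have [] := @bezout_avoid_primes (primes d) p q x0 y0 (primes_uniq d) _ E0.
- by apply/allP => r; rewrite mem_primes => /andP[].
(* For [d] even, the parity hypothesis makes [p + q] odd, hence [p q] even. *)
- rewrite mem_primes => /and3P[_ _ d2]; rewrite -PoszM dvdzE /= dvdn2.
  by move: odd_pq d2; rewrite dvdn2 !oddD !oddM; case: (odd d); case: (odd p); case: (odd q).
move=> x [y [E good]].
have copr (r : nat) : prime r -> (r %| d)%N -> ~~ (r %| x)%Z && ~~ (r %| y)%Z.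
  by move=> pr rd; apply: good; rewrite mem_primes pr d0.
have dp0 : (0 < d * p)%N by rewrite muln_gt0 d0.
have dq0 : (0 < d * q)%N by rewrite muln_gt0 d0.
pose x' := `|(x %% (d * p)%N)%Z|%N; pose y' := `|(y %% (d * q)%N)%Z|%N.
have x'E : (x' : int) = (x %% (d * p)%N)%Z by rewrite abszE Num.Theory.ger0_norm // modz_ge0 //; lia.
have y'E : (y' : int) = (y %% (d * q)%N)%Z by rewrite abszE Num.Theory.ger0_norm // modz_ge0 //; lia.
have coprimeI (u v : nat) : (0 < v)%N ->
    (forall r, prime r -> (r %| u)%N -> (r %| v)%N -> False) -> coprime u v.
  move=> v0 H; apply: contraT => uv; have g1 : (1 < gcdn u v)%N.
    by rewrite ltn_neqAle eq_sym uv gcdn_gt0 v0 orbT.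
  case: (H (pdiv (gcdn u v))); first exact: pdiv_prime.
    exact: dvdn_trans (pdiv_dvd _) (dvdn_gcdl _ _).
  exact: dvdn_trans (pdiv_dvd _) (dvdn_gcdr _ _).
(* Primes dividing [d] are avoided by [copr]; those dividing [p] or [q] are excluded by the Bezout
   relation. *)
have no_prime r : prime r -> (r %| (q : int) * x)%Z -> (r %| (p : int) * y)%Z -> False.
  by move=> pr rx ry; have : (r %| (1 : int))%Z; [rewrite -E rpredD | rewrite dvdzE /= dvdn1; case: r pr {rx ry} => [|[]]].
exists x', y'; split.
- by rewrite -ltz_nat x'E ltz_pmod //; lia.
- apply/eqP; rewrite -eqz_nat -!modz_nat eqz_mod_dvd PoszD !PoszM x'E y'E.
  apply/dvdzP; exists (- ((x %/ (d * p)%N)%Z + (y %/ (d * q)%N)%Z)).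
  rewrite -[Posz 1]E; have := divz_eq x (d * p)%N; have := divz_eq y (d * q)%N.
  move: (x %/ _)%Z (x %% _)%Z (y %/ _)%Z (y %% _)%Z => u u' v v' -> ->; rewrite !PoszM; ring.
- apply: coprimeI => // r pr rx rdp.
  have {}rx : (r %| x)%Z.
    rewrite (divz_eq x (d * p)%N) -x'E rpredD //; first by rewrite dvdz_mull.
  move: rdp; rewrite Euclid_dvdM // => /orP[rd | rp].
    by case/andP: (copr r pr rd) => /negP.
  by apply: (no_prime r pr); [rewrite dvdz_mull | rewrite dvdz_mulr].
apply: coprimeI => // r pr ry rdq.
have {}ry : (r %| y)%Z.
  by rewrite (divz_eq y (d * q)%N) -y'E rpredD // dvdz_mull.
move: rdq; rewrite Euclid_dvdM // => /orP[rd | rq].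
  by case/andP: (copr r pr rd) => _ /negP.
by apply: (no_prime r pr); [rewrite dvdz_mulr | rewrite dvdz_mull].
Qed.

Definition Zp_order (N : nat) (s : 'Z_N) (b : nat) :=
  (forall j, (0 < j < b)%N -> s *+ j != 0) /\ s *+ b = 0.

Lemma Zp_order_natr (N q b v : nat) : (1 < N)%N -> N = (q * b)%N -> coprime v b ->
  Zp_order ((q * v)%:R : 'Z_N) b.
Proof.
move=> N1 NE co; split => [j jb|]; last by apply/eqP; rewrite (Zp_natr_order _ N1 NE co).
rewrite (Zp_natr_order _ N1 NE co); apply/negP => /dvdn_leq; lia.
Qed.

Lemma rigid_4_3 k : odd k -> rigid_dessin_type (k * 12) 3 4 (k * 12).
Proof.
move=> k_odd; have s3 : Zp_order (4%:R : 'Z_12) 3 by exact: (@Zp_order_natr 12 4 3 1).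
have t4 : Zp_order (1 - 4%:R : 'Z_12) 4.
  by rewrite (_ : 1 - 4%:R = (3 * 3)%:R); [exact: Zp_order_natr | apply: val_inj].
case: k k_odd => [|[|k]] /= k_odd; first by [].
  rewrite mul1n; apply: (@rigid_twisted 12 4 3 4 4%:R) => //; by [left | case: s3 | case: t4 | right].
apply: (@rigid_chain k.+1 12 4 3 4) => //; rewrite ?/= ?negbK //; try by [case: s3 | case: t4 | right].
by rewrite ltnS; case: k k_odd.
Qed.

(** The translations are 2 and [-1], both of order [N] as [N] is odd. The chain needs
    [1 < s' < N - 1], hence [s = 2]; the single copy takes [s = -1], [m = 1], so that [2 m + 2 < N]
    holds already for [N = 5]. *)
Lemma rigid_equal_valencies N k : odd k -> odd N -> (4 < N)%N -> rigid_dessin_type (k * N) N N (k * N).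
Proof.
move=> k_odd N_odd N4; have N1 : (1 < N)%N by lia.
have coN : coprime N.-1 N.
  by rewrite coprime_sym; case: N N4 {N_odd N1} => // n _; rewrite coprimeSn.
have s2 : Zp_order (2%:R : 'Z_N) N.
  by apply: (@Zp_order_natr N 1 N 2) => //; rewrite ?mul1n // coprime2n.
have NE : - 1 = (1 * N.-1)%:R :> 'Z_N.
  by rewrite mul1n -subn1 natrB ?pchar_Zp ?sub0r //; lia.
have t1 : Zp_order (- 1 : 'Z_N) N.
  by rewrite NE; apply: Zp_order_natr; rewrite ?mul1n.
have tE : 1 - 2%:R = -1 :> 'Z_N by ring.
case: k k_odd => [|[|k]] //= k_odd.
  rewrite mul1n; apply: (@rigid_twisted N N N 1 (-1)); rewrite ?opprK //;
    by [lia | right | left | case: t1 | case: s2].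
apply: (@rigid_chain k.+1 N N N 2); rewrite ?tE /= ?negbK //;
  by [lia | left | case: t1 | case: s2].
Qed.

Lemma rigid_double_valency b : (3 < b)%N -> rigid_dessin_type (2 * b) b (2 * b) (2 * b).
Proof.
move=> b3; have N1 : (1 < 2 * b)%N by lia.
have s2 : Zp_order (2%:R : 'Z_(2 * b)) b by apply: (@Zp_order_natr (2 * b) 2 b 1) => //; rewrite coprime1n.
have NE : - 1 = (1 * (2 * b).-1)%:R :> 'Z_(2 * b).
  by rewrite mul1n -subn1 natrB ?pchar_Zp ?sub0r //; lia.
have t1 : Zp_order (- 1 : 'Z_(2 * b)) (2 * b).
  rewrite NE; apply: Zp_order_natr; rewrite ?mul1n // coprime_sym.
  by case: b b3 {N1 NE s2} => // n _; rewrite mulnS coprimeSn.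
have tE : 1 - 2%:R = -1 :> 'Z_(2 * b) by ring.
apply: (@rigid_twisted (2 * b) (2 * b) b 2 2%:R); rewrite ?tE //;
  by [lia | left | case: s2 | case: t1 | left; lia].
Qed.

(** Both [N] and [s = q x] are multiples of [q], which keeps [s] away from forbidden values: for
    [q >= 2] it is neither 1 nor [N - 1]. On a single copy [2 s] differs from [N] because [b > 2],
    hence by at least 3 when [q >= 3], and [m] is the smaller of [s] and [N - s]. *)
Lemma rigid_valencies_ge3 (k d p q : nat) (N := (d * p * q)%N) :
    odd k -> coprime p q -> (0 < p <= q)%N -> odd (N + p + q) -> (2 < d * p)%N ->
    (4 < d * q)%N -> ~~ [&& k == 1, d == 3%N, p == 1%N & q == 2%N] ->
  rigid_dessin_type (k * N) (d * p) (d * q) (k * N).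
Proof.
move=> k_odd pq /andP[p0 pq_le] N_odd b2 a4 not6.
have q0 : (0 < q)%N by lia.
have d0 : (0 < d)%N by move: b2; case: (d).
have N4 : (4 < N)%N by rewrite /N mulnAC; apply: (leq_trans a4); rewrite leq_pmulr.
have N1 : (1 < N)%N by lia.
have [q1|q_neq1] := eqVneq q 1%N.
  have p1 : p = 1%N by lia.
  rewrite /N p1 q1 !muln1; apply: rigid_equal_valencies => //.
    by move: N_odd; rewrite /N p1 q1 !muln1 !addn1 /= negbK.
  by rewrite q1 muln1 in a4.
have [x [y [xb E xco yco]]] := coprime_bezout_split d0 p0 q0 pq N_odd.
have NE : N = (q * (d * p))%N by rewrite mulnC.
have NE' : N = (p * (d * q))%N by rewrite /N mulnAC mulnC.
have s_order := Zp_order_natr N1 NE xco.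
have t_order := Zp_order_natr N1 NE' yco.
have tE : 1 - (q * x)%:R = (p * y)%:R :> 'Z_N.
  apply/eqP; rewrite subr_eq -natrD addnC eq_sym -(Zp_nat_mod N1) E (Zp_nat_mod N1) //.
have s'N : (q * x < N)%N by rewrite NE ltn_pmul2l.
have x0 : (0 < x)%N.
  by case: x xco {xb E s_order tE s'N} => //; rewrite /coprime gcd0n => /eqP; lia.
rewrite -tE in t_order.
have qN : (q %| N)%N by rewrite NE dvdn_mulr.
have [k1|k_neq1] := eqVneq k 1%N.
  have [q2|q_neq2] := eqVneq q 2%N.
    have p1 : p = 1%N by clear -pq p0 pq_le q2; subst q; move: pq; rewrite coprimen2; lia.
    rewrite k1 mul1n /N p1 q2 muln1 mulnC; apply: rigid_double_valency.
    by move: not6 b2; rewrite k1 p1 q2; lia.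
  have q3 : (3 <= q)%N by lia.
  have gap r : (q %| r)%N -> (0 < r)%N -> (3 <= r)%N.
    by move=> qr r0; apply: leq_trans q3 (dvdn_leq r0 qr).
  have qs : (q %| (q * x).*2)%N by rewrite -muln2 -mulnA dvdn_mulr.
  have s0 : (0 < q * x)%N by rewrite muln_gt0 q0.
  have d0_b0 : (0 < d * p)%N by lia.
  have [s_ord s_exp] := s_order; have [t_ord t_exp] := t_order.
  rewrite k1 mul1n.
  have [xN|xN] := ltnP (q * x).*2 N.
    have := gap (N - (q * x).*2)%N (dvdn_sub qN qs); rewrite subn_gt0 => /(_ xN) gapN.
    apply: (@rigid_twisted N (d * q) (d * p) (q * x) (q * x)%:R s0 _ _ d0_b0 s_ord s_exp t_ord t_exp).
    - by clear -gapN; clearbody N; move: (q * x)%N gapN => r; lia.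
    - by left.
    by left.
  have xN' : (0 < (q * x).*2 - N)%N.
    rewrite subn_gt0 ltn_neqAle xN andbT; apply/eqP => NE2.
    have /negP[] := s_ord 2%N b2; apply/eqP; rewrite -mulrnA muln2 -NE2.
    by rewrite pchar_Zp.
  have := gap _ (dvdn_sub qs qN) xN' => gapN.
  apply: (@rigid_twisted N (d * q) (d * p) (N - q * x) (q * x)%:R _ _ _ d0_b0 s_ord s_exp t_ord t_exp).
  - by rewrite subn_gt0.
  - by clear -gapN s'N; clearbody N; move: (q * x)%N gapN s'N => r; lia.
  - by right; rewrite natrB ?pchar_Zp ?sub0r ?opprK // ltnW.
  by left.
case: k k_odd k_neq1 {not6} => [//|k /= k_odd k_neq1].
apply: (@rigid_chain k N (d * q) (d * p) (q * x)); try by [|case: s_order|case: t_order|left].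
  by case: k k_odd k_neq1 => [|[]].
have q_gt1 : (1 < q)%N by rewrite ltn_neqAle eq_sym q_neq1.
have N0 : (0 < N)%N := ltnW N1.
apply/andP; split; first exact: leq_trans q_gt1 (leq_pmulr q x0).
rewrite ltn_neqAle -ltnS prednK // s'N andbT; apply/eqP => xE.
have : (q %| N - q * x)%N by rewrite dvdn_sub // dvdn_mulr.
by rewrite xE -subn1 subKn // dvdn1 (negPf q_neq1).
Qed.

Local Close Scope ring_scope.

(** * Reduction *)

Lemma rigid_uniform (k d p q : nat) (N := d * p * q) :
    odd k -> coprime p q -> 0 < p <= q -> odd (N + p + q) -> k * p + k * q + 3 <= k * N ->
  rigid_dessin_type (k * N) (d * p) (d * q) (k * N).
Proof.
move=> k_odd pq /andP[p0 pq_le] N_odd large.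
have d0 : 0 < d by case: (posnP d) => // d0; move: large; rewrite /N d0 !mul0n; lia.
have q0 := leq_trans p0 pq_le.
have [b3|b2] := ltnP 2 (d * p).
  have [a4|a4] := ltnP 4 (d * q).
    have [/and4P[/eqP-> /eqP dE /eqP pE /eqP qE]|not6] :=
        boolP [&& k == 1, d == 3, p == 1 & q == 2].
      by rewrite /N dE pE qE; apply: rigid_6_3.
    by apply: rigid_valencies_ge3; rewrite ?p0.
  have dp : d * p <= d * q by rewrite leq_mul2l pq_le orbT.
  (* The pairs of valencies are 3, 3, then 4, 3, and finally 4, 4, which parity rules out. *)
  have {dp} : [\/ [/\ d = 3, p = 1 & q = 1], [/\ d = 1, p = 3 & q = 4] | [/\ d = 4, p = 1 & q = 1]].
    have d4 : d <= 4 by apply: leq_trans a4; apply: leq_pmulr.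
    have q4 : q <= 4 by apply: leq_trans a4; apply: leq_pmull.
    have p4 : p <= 4 by apply: leq_trans q4.
    clear -d4 q4 p4 pq pq_le b3 a4; move: d4 p4 q4 b3 a4 pq_le pq.
    case: d => [|[|[|[|[|d]]]]] // _; case: p => [|[|[|[|[|p]]]]] // _;
      case: q => [|[|[|[|[|q]]]]] // _ b3 a4 pq_le pq; vm_compute in b3, a4, pq_le, pq;
      by [apply: Or31 | apply: Or32 | apply: Or33].
  case=> -[dE pE qE]; move: large N_odd; rewrite /N dE pE qE => large N_odd.
  - by apply: rigid_3_3 => //; lia.
  - exact: rigid_4_3.
  by [].
(* Here [b = 1] contradicts the genus bound; otherwise [b = 2], with [a = 2 q] and [q] even when
   [d = 2], and [a = q] odd when [d = 1]. *)
have {b2} [[dE pE]|[[dE pE]|[dE pE]]] : d = 1 /\ p = 1 \/ (d = 2 /\ p = 1 \/ d = 1 /\ p = 2).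
  by move: b2 d0 p0; clear; case: d => [|[|[|d]]]; case: p => [|[|[|p]]]; lia.
- by move: large; rewrite /N dE pE !mul1n; nia.
- have q_even : ~~ odd q by move: N_odd; rewrite /N dE pE; lia.
  rewrite /N dE pE !muln1 mul2n.
  have [k1|k1] := eqVneq k 1.
    by rewrite k1 mul1n; apply: rigid_2_even_one => //; move: large; rewrite /N k1 dE pE; lia.
  rewrite -(odd_double_half k) k_odd add1n; apply: rigid_2_even => //; last by lia.
  by move: large; rewrite /N dE pE; case: (q) => [|[|]] //; lia.
have q_odd : odd q by rewrite -coprime2n -pE.
rewrite /N dE pE !mul1n; have [k1|k1] := eqVneq k 1.
  by rewrite k1 mul1n; apply: rigid_2_odd_one => //; move: large; rewrite /N k1 dE pE; lia.
rewrite mulnA muln2; apply: rigid_2_odd => //; first by lia.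
by move: large; rewrite /N dE pE; case: (q) q_odd => [|[|[|]]] //; lia.
Qed.

Import Num.Theory.

Lemma passport_genus_ge2 (n p q : nat) :
    passport_genus n p q 1 \is a Num.int -> (2%:R <= passport_genus n p q 1)%R ->
  exists m, n = p + q + 3 + m.*2.
Proof.
move=> /intrP[z]; rewrite /passport_genus => gE; rewrite gE => z2.
have {}z2 : (2 <= z)%R by rewrite -(ler_int rat).
have E : (n%:Z = (p + q + 1)%N%:Z + (z - 1) * 2)%R.
  apply: (@intr_inj rat); rewrite rmorphD rmorphM rmorphB /= -gE addrK.
  by rewrite -!pmulrn divfK // addrC subrK.
(* The genus is [z], and [n = p + q + 1 + 2 (z - 1)]. *)
exists `|z - 2|%N; lia.
Qed.

Lemma rigid_dessin_genus_ge2 (a b p q n : nat) :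
    0 < a -> 0 < b -> 0 < p -> 0 < q -> n = p * a -> n = q * b ->
    passport_genus n p q 1 \is a Num.int -> (2%:R <= passport_genus n p q 1)%R ->
  rigid_dessin_type n a b n.
Proof.
move=> a0 b0 p0 q0 na nb g1 g2; have [m {g1 g2}] := passport_genus_ge2 g1 g2.
wlog ba : a b p q a0 b0 p0 q0 na nb / b <= a => [W nE|nE].
  have [ba|/ltnW ab] := leqP b a; first exact: (W a b p q).
  by apply/rigid_dessin_typeC/(W b a q p) => //; rewrite (addnC q).
apply: rigid_dessin_typeC.
have d0 : 0 < gcdn a b by rewrite gcdn_gt0 a0.
have /dvdnP[q' aE] := dvdn_gcdl a b; have /dvdnP[p' bE] := dvdn_gcdr a b.
set d := gcdn a b in d0 aE bE.
have co : coprime p' q'.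
  by rewrite coprime_sym /coprime -(eqn_pmul2r d0) mul1n muln_gcdl -aE -bE.
have pq : p * q' = q * p'.
  by apply/eqP; rewrite -(eqn_pmul2r d0) -!mulnA -aE -bE -na -nb.
have /dvdnP[k pE] : p' %| p by rewrite -(Gauss_dvdl _ co) pq dvdn_mull.
have p'0 : 0 < p' by rewrite lt0n; apply: contraTneq b0 => p'E; rewrite bE p'E.
have qE : q = k * q'.
  by apply/eqP; rewrite -(eqn_pmul2r p'0) -pq pE mulnAC.
have nkE : n = k * (d * p' * q') by rewrite na pE {1}aE; lia.
(* Integrality of the genus makes [n + p + q] odd, and this sum is [k] times the second factor. *)
have odd_n : odd k && odd (d * p' * q' + p' + q').
  have : odd (n + p + q) by rewrite nE; lia.
  by rewrite nkE pE qE -!mulnDr oddM.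
case/andP: odd_n => k_odd N_odd.
have -> : a = d * q' by rewrite mulnC.
have -> : b = d * p' by rewrite mulnC.
rewrite nkE; apply: rigid_uniform => //.
  by rewrite p'0 -(leq_pmul2r d0) -aE -bE.
by rewrite -pE -qE -nkE nE; lia.
Qed.

Theorem theorem5p2 (a b p q n : nat)
    (a_gt0 : 0 < a) (b_gt0 : 0 < b) (p_gt0 : 0 < p) (q_gt0 : 0 < q)
    (n_gt0 : 0 < n) (n_pa : n = p * a) (n_qb : n = q * b)
    (genus_int : passport_genus n p q 1 \is a Num.int)
    (genus_ge2 : (2%:R <= passport_genus n p q 1)%R)
    (P : 3.-tuple (seq nat))
    (P_perm : perm_eq P [:: nseq p a; nseq q b; [:: n]]) :
  exists D : dessin, passport D = P /\ dessin_aut D = 1%G.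
Proof.
have H := rigid_dessin_genus_ge2 a_gt0 b_gt0 p_gt0 q_gt0 n_pa n_qb genus_int genus_ge2.
have n1 : n = 1 * n by rewrite mul1n.
case/(perm_iotaP [::]): P_perm => /= I; rewrite -mem_permutations.
have -> : permutations [:: 0; 1; 2] =
    [:: [:: 1; 0; 2]; [:: 0; 1; 2]; [:: 2; 0; 1]; [:: 0; 2; 1]; [:: 1; 2; 0]; [:: 2; 1; 0]].
  by vm_compute.
have realize m0 m1 m2 l0 l1 l2 : n = m0 * l0 -> n = m1 * l1 -> n = m2 * l2 ->
    rigid_dessin_type n l0 l1 l2 -> P = [:: nseq m0 l0; nseq m1 l1; nseq m2 l2] :> seq _ ->
    exists D : dessin, passport D = P /\ dessin_aut D = 1%G.
  move=> h0 h1 h2 /(rigid_dessin_of_type h0 h1 h2 n_gt0)[D [DP D1]] PE.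
  by exists D; split=> //; rewrite DP; apply/val_inj/esym.
have C := rigid_dessin_typeC; have R := rigid_dessin_typeR.
rewrite !inE => /or4P[|||/or3P[]] /eqP-> PE.
- exact: (realize q p 1 b a n) (C _ _ _ _ H) PE.
- exact: (realize p q 1 a b n) H PE.
- exact: (realize 1 p q n a b) (C _ _ _ _ (R _ _ _ _ H)) PE.
- exact: (realize p 1 q a n b) (R _ _ _ _ H) PE.
- exact: (realize q 1 p b n a) (R _ _ _ _ (C _ _ _ _ H)) PE.
exact: (realize 1 q p n b a) (C _ _ _ _ (R _ _ _ _ (C _ _ _ _ H))) PE.
Qed.
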